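(* There exists an Asplund Banach space $\mathcal{X}$ with a $1$-norming Markuševič basis such that $\mathcal{X}$ is not weakly compactly generated.
   Context: Banach spaces are over $\mathbb{R}$ or $\mathbb{C}$ (the result is valid for either scalar field). A Banach space $\mathcal{X}$ is Asplund if every convex continuous function defined on a convex open subset $U$ of $\mathcal{X}$ is Fréchet differentiable on a dense $G_\delta$ subset of $U$ (equivalently, every separable subspace of $\mathcal{X}$ has separable dual). $\mathcal{X}$ is weakly compactly generated (WCG) if it admits a weakly compact subset whose linear span is dense in $\mathcal{X}$. A biorthogonal system in $\mathcal{X}$ is a system $\{x_\gamma;\varphi_\gamma\}_{\gamma\in\Gamma}$ with $x_\gamma\in\mathcal{X}$, $\varphi_\gamma\in\mathcal{X}^*$ and $\langle\varphi_\alpha,x_\beta\rangle=\delta_{\alpha,\beta}$ for all $\alpha,\beta\in\Gamma$. It is a Markuševič basis (M-basis) if $\mathrm{span}\{x_\gamma\}_{\gamma\in\Gamma}$ is norm-dense in $\mathcal{X}$ and $\mathrm{span}\{\varphi_\gamma\}_{\gamma\in\Gamma}$ is $w^*$-dense in $\mathcal{X}^*$. For $0<\lambda\leq 1$, an M-basis is $\lambda$-norming if $$\lambda\|x\|\leq\sup\{|\langle\varphi,x\rangle|\colon \varphi\in\mathrm{span}\{\varphi_\gamma\}_{\gamma\in\Gamma},\ \|\varphi\|\leq 1\}\qquad\text{for all }x\in\mathcal{X}.$$ *)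

(* Defs.v *)
From mathcomp Require Import all_boot all_order all_algebra.
From mathcomp Require Import all_classical all_reals all_analysis.
From mathcomp Require Import borel_hierarchy.
From mathcomp Require Export complex.

Set Implicit Arguments.
Unset Strict Implicit.
Unset Printing Implicit Defensive.

Import Order.TTheory GRing.Theory Num.Theory.
Import numFieldNormedType.Exports.

Local Open Scope classical_set_scope.
Local Open Scope ring_scope.

(* The scalar field K is meant to be a realType R or its complexification R[i].
   In both cases norms take their values in K and x <= y entails that y - x is
   real, so that {i01 K} is the real interval [0, 1]; real-valued functions are
   the K-valued functions whose values satisfy Num.real. *)

Section LinearSpan.
Context {K : numFieldType} {V : lmodType K}.

Definition lin_span (A : set V) : set V :=
  [set v | exists n (c : 'I_n -> K) (a : 'I_n -> V),
     (forall i, A (a i)) /\ v = \sum_(i < n) c i *: a i].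

End LinearSpan.

Section BanachSpace.
Context {K : numFieldType}.
Variable X : completeNormedModType K.

Definition dual : set (X -> K^o) :=
  [set phi | linear phi /\ continuous phi].

(* For K = R[i], the upper bounds of a nonempty set of real numbers are real,
   so the least upper bound for the order of K is the usual supremum. *)
Definition dual_norm (phi : X -> K^o) : K :=
  supremum (0 : K) [set `|phi x| | x in [set x : X | `|x| <= 1]].

Definition weak_space : topologicalType :=
  initial_topology
    (fun (x : X) => (fun phi => val phi x) : {ptws set_type dual -> K^o}).

Definition weakstar_space : topologicalType :=
  initial_topology (fun phi : set_type dual => val phi : {ptws X -> K^o}).

Definition weakly_compactly_generated :=
  exists A : set X,
    compact (A : set weak_space) /\ dense (lin_span A).

(* Differentiability is with respect to the underlying real space of X: the
   differential of a real-valued function is only real-linear. *)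
Definition frechet_differentiable (f : X -> K^o) (x : X) :=
  exists L : X -> K^o,
    [/\ forall u v, L (u + v) = L u + L v,
        forall t u, t \is Num.real -> L (t *: u) = t *: L u,
        continuous L
      & (fun h : X => f (x + h) - f x - L h) =o_ (0 : X) (fun h : X => h)].

Definition Asplund :=
  forall (U : set X) (f : X -> K^o),
    open U -> convex_set U ->
    (forall x, U x -> f x \is Num.real) ->
    convex_function U f -> {within U, continuous f} ->
    exists D : set X,
      [/\ D `<=` U, Gdelta D, U `<=` closure D
        & forall x, D x -> frechet_differentiable f x].

Section Systems.
Variables (Gamma : Type) (x : Gamma -> X) (phi : Gamma -> X -> K^o).

Definition biorthogonal_system :=
  (forall g, dual (phi g)) /\
  (forall a b, phi a (x b) = (`[< a = b >])%:R).

Definition markushevich_basis :=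
  [/\ biorthogonal_system,
      dense (lin_span (range x))
    & dense ([set psi | lin_span (range phi) (val psi)] : set weakstar_space)].

Definition norming (lambda : K) :=
  forall y : X,
    lambda * `|y| <=
      supremum (0 : K) [set `|psi y| | psi in
        [set psi | lin_span (range phi) psi /\ dual_norm psi <= 1]].

Definition norming_markushevich_basis (lambda : K) :=
  markushevich_basis /\ norming lambda.

End Systems.
End BanachSpace.

(* Main.v *)
Require Import Defs.
From HB Require Import structures.
From mathcomp Require Import all_boot all_order all_algebra.
From mathcomp Require Import all_classical all_reals all_analysis.
From mathcomp Require Import wochoice borel_hierarchy.
From mathcomp Require Import lra ring zify.
Set Implicit Arguments.
Unset Strict Implicit.
Unset Printing Implicit Defensive.
Import Order.TTheory GRing.Theory Num.Theory.
Import numFieldNormedType.Exports.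
Local Open Scope classical_set_scope.
Local Open Scope ring_scope.

(** The idea is to find a compact set of subsets of an uncountable well-ordered
set [G], all of whose initial segments are countable, that contains on the one
hand all initial segments of [G] and on the other hand a dense set of finite
sets, while its members are all of these two kinds, initial segments and finite
sets. The Banach space is the closed linear span, among the bounded functions on
the compact set, of the coordinate functions, one for each [g] in [G], telling
whether [g] belongs to a set.

Such a compact set is the closure of the finite sets [ladder a n], for [a] in
[G] and [n] an integer. For fixed [a] they increase to the initial segment
ending at [a]; they are coherent ([ladder_trans]), and their size is bounded by
a function of [n] alone ([ladder_size]). If [n] is unbounded along a family of
ladders, coherence turns its limits into initial segments, and otherwise the
size bound makes them finite ([ladder_closure_dichotomy]). The ladders are
constructed by recursion on [a], and the recursion can go on past countably many
points because their size is kept o(n).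

The coordinate functions and the evaluations at singletons are biorthogonal.
Evaluation at a finite set is the sum of the evaluations at its elements
([app_ladder]), it has norm at most one, and finite sets are dense; hence the
system is a 1-norming Markushevich basis ([ladder_markushevich]).

The space is not weakly compactly generated because evaluation at the initial
segments behaves like the points of the ordinal interval up to the first
uncountable ordinal. Every weakly compact set is blind to the difference between
[G] and some countable initial segment ([weakly_compact_segment]), but the
coordinate functions are not.

For the Asplund property, let [f] be continuous and convex on an open set. By a
separable reduction ([flat_ball_exists]) one may restrict to countably many
coordinates, that is, to functions on a compact set with countably many points,
since finite sets and initial segments leave only countably many traces on a
countable set ([ladder_closure_traces]). There, every functional is a norm limit
of rational combinations of evaluations ([atomic_approximation]), so a
countable family of functionals contains approximate subgradients of [f] at
every point, and by the Baire category theorem one of them serves on a whole ball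
([small_second_difference]). On that ball [f] is close to an affine function.
Doing this with ever smaller errors gives a dense countable intersection of open
sets ([generic_differentiability]), at the points of which a subgradient of [f]
is its derivative. Complex spaces are treated through the underlying real
spaces. *)


(** * An uncountable well-order with countable initial segments *)

Record omega1 := Omega1 {
  o1 :> choiceType;
  o1lt : rel o1;
  o1wf : well_founded o1lt;
  o1irr : irreflexive o1lt;
  o1trans : transitive o1lt;
  o1total : forall x y, [\/ o1lt x y, x = y | o1lt y x];
  o1count : forall x, countable [set y | o1lt y x];
  o1uncount : ~ countable [set: o1] }.

Lemma uncountable_set_nat : ~ countable [set: set nat].
Proof.
move=> /countable_injP[f finj].
pose D := [set n | exists2 B : set nat, f B = n & ~ B n].
have [DfD|nDfD] := pselect (D (f D)).
  have [B fB nB] := DfD.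
  by apply: nB; rewrite (finj _ _ _ _ fB) ?in_setT.
by apply: (nDfD); exists D.
Qed.

(** In a well-ordered uncountable set, the points whose initial segments are
countable form an uncountable initial segment: were it countable, the least
point outside would have it as its own segment. *)
Lemma omega1_exists : inhabited omega1.
Proof.
have [R Rwo] := well_ordering_principle (set nat).
have Rtot x y : R x y || R y x.
  have [|z [[zA zle] _]] := Rwo (pred2 x y).
    by exists x; rewrite inE eqxx.
  move: zA; rewrite inE => /orP[] /eqP zE; subst z.
    by rewrite zle// inE eqxx orbT.
  by rewrite orbC zle// inE eqxx.
have Rxx x : R x x by have := Rtot x x; rewrite orbb.
have Ranti x y : R x y -> R y x -> x = y.
  move=> xy yx; have [|z [_ zuniq]] := Rwo (pred2 x y).
    by exists x; rewrite inE eqxx.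
  rewrite -(zuniq x) ?(zuniq y)//.
    split; first by rewrite inE eqxx orbT.
    by move=> t; rewrite inE => /orP[] /eqP->.
  split; first by rewrite inE eqxx.
  by move=> t; rewrite inE => /orP[] /eqP->.
have Rtrans x y z : R x y -> R y z -> R x z.
  move=> xy yz; have [|t [[tA tle] _]] := Rwo (pred3 x y z).
    by exists x; rewrite inE eqxx.
  move: tA; rewrite inE => /or3P[] /eqP tE; subst t.
  - by rewrite tle// inE eqxx !orbT.
  - by rewrite (Ranti x y)// tle// inE eqxx.
  - have zy : z = y by apply: Ranti => //; rewrite tle// inE eqxx ?orbT.
    by rewrite zy.
pose lt x y := ~~ R y x.
have ltR x y : lt x y -> R x y.
  by rewrite /lt => /negPf nyx; have := Rtot x y; rewrite nyx orbF.
have ltirr : irreflexive lt by move=> x; rewrite /lt Rxx.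
have lttrans : transitive lt.
  move=> y x z xy yz; rewrite /lt; apply/negP => zx.
  by move: xy; rewrite /lt => /negP; apply; apply: (Rtrans _ z) => //; apply: ltR.
have lttot x y : [\/ lt x y, x = y | lt y x].
  rewrite /lt; have [yx|nyx] := boolP (R y x); last exact: Or31.
  have [xy|nxy] := boolP (R x y); last exact: Or33.
  by apply: Or32; apply: Ranti.
have minP (P : set (set nat)) : P !=set0 ->
    exists2 m, P m & forall y, lt y m -> ~ P y.
  move=> [x Px]; have [|m [[mP mle] _]] := Rwo [pred x | `[< P x >]].
    by exists x; exact/asboolP.
  exists m; first exact/asboolP.
  by move=> y ym Py; move: ym; rewrite /lt (mle y (asboolT Py)).
have ltwf : well_founded lt.
  move=> x; apply: contrapT => nAx.
  have [m nAm mmin] := minP [set x | ~ Acc lt x] (ex_intro _ x nAx).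
  by apply: nAm; constructor => y /mmin /contrapT.
pose C := [pred x | `[< countable [set y | lt y x] >]].
have CP x : reflect (countable [set y | lt y x]) (C x) by exact: asboolP.
have Cdown x y : lt y x -> C x -> C y.
  move=> yx /CP Cx; apply/CP; apply: sub_countable Cx.
  by apply: subset_card_le => z /= zy; apply: lttrans yx.
pose G := {x | C x} : choiceType.
have valcount (B : set G) : countable (val @` B) -> countable B.
  move=> /countable_injP[f finj]; apply/countable_injP; exists (f \o val).
  move=> x y /set_mem Bx /set_mem By /= fxy; apply: val_inj.
  by apply: finj fxy; apply: mem_set; [exists x|exists y].
have Gcount (x : G) : countable [set y : G | lt (val y) (val x)].
  apply: valcount; have /CP := valP x; apply: sub_countable.
  by apply: subset_card_le => _ [y yx <-].
have Guncount : ~ countable [set: G].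
  move=> Gc.
  have Cc : countable [set x | C x].
    have := card_le_trans (card_image_le (val : G -> set nat) setT) Gc.
    apply: sub_countable; apply: subset_card_le => x Cx.
    by exists (Sub x Cx : G) => //=; rewrite SubK.
  have [|m nCm mmin] := minP [set x | ~ C x].
    apply: contrapT => /forallNP allC; apply: uncountable_set_nat.
    by apply: sub_countable Cc; apply: subset_card_le => x _; have /contrapT := allC x.
  apply: nCm; apply/CP; apply: sub_countable Cc; apply: subset_card_le => x xm.
  by apply: contrapT => nCx; exact: (mmin x xm nCx).
pose ltG : rel G := fun x y => lt (val x) (val y).
have wfG : well_founded (fun x y => ltG x y).
  move=> x; move: {2}(val x) (erefl (val x)) => u.
  elim: (ltwf u) x => {}u _ IH x xu; constructor => y yx.
  by apply: (IH (val y)) => //; rewrite -xu.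
have irrG : irreflexive ltG by move=> x; apply: ltirr.
have transG : transitive ltG by move=> y x z; apply: lttrans.
have totG (x y : G) : [\/ ltG x y, x = y | ltG y x].
  have [?|/val_inj ?|?] := lttot (val x) (val y); by [apply: Or31|apply: Or32|apply: Or33].
exact: (inhabits (Omega1 wfG irrG transG totG Gcount Guncount)).
Qed.

(** * Slowly growing ladders *)

(** Values in [option T], because [B] may be empty. *)
Lemma countable_enum (T : Type) (B : set T) : countable B ->
  exists c : nat -> option T, (forall j b, c j = Some b -> B b) /\
    (forall b, B b -> exists j, c j = Some b).
Proof.
move=> /countable_injP[f finj].
pose P j b := B b /\ f b = j.
have Pex j : exists o : option T, (forall b, o = Some b -> P j b) /\
    (o = None -> forall b, ~ P j b).
  have [[b Pb]|nP] := pselect (exists b, P j b).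
    by exists (Some b); split=> // _ [<-].
  by exists None; split=> // _ b Pb; apply: nP; exists b.
have [c cP] := choice Pex; exists c; split=> [j b /(proj1 (cP j)) []//|b Bb].
exists (f b); case cE : (c (f b)) => [b'|].
  have [Bb' fE] := proj1 (cP (f b)) _ cE.
  by congr Some; apply: finj fE; apply: mem_set.
by have := proj2 (cP (f b)) cE b; case.
Qed.

Section Ladder.
Variable G : omega1.
Local Notation lt := (@o1lt G).
Implicit Types (F : G -> nat -> seq G) (a b : G).
Local Open Scope nat_scope.

Definition below a : nat -> option G := projT1 (cid (countable_enum (o1count a))).

Lemma below_lt a j b : below a j = Some b -> lt b a.
Proof. by move=> aj; have [h _] := projT2 (cid (countable_enum (o1count a))); apply: h aj. Qed.

Lemma below_onto a b : lt b a -> exists j, below a j = Some b.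
Proof. by have [_ h] := projT2 (cid (countable_enum (o1count a))); apply: h. Qed.

(** At the point [a], the list of level [n] is built by stacking the lists of
level [n] at the first few predecessors of [a], in an enumeration of the
predecessors fixed once and for all. How many are stacked is [slow F a n]: it
tends to infinity, so that every predecessor is eventually reached, but slowly
enough for [slow F a n] times the size of the stack to stay below [n] from then
on, so that the size of the stack is o(n). *)
Definition rung F a j n := if below a j is Some b then F b n else [::].

Definition stack F a k n := flatten [seq rung F a j n | j <- iota 0 k].

Definition slow F a n :=
  \max_(k < n.+1 | `[< forall m, n <= m -> k * size (stack F a k m) <= m >]) k.

Definition extend F a n := a :: stack F a (slow F a n) n.

Lemma eq_extend F F' a : (forall b, lt b a -> F b = F' b) ->
  extend F a = extend F' a.
Proof.
move=> FF'; have rE : rung F a = rung F' a.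
  apply/funext => j; apply/funext => n; rewrite /rung.
  by case E : (below a j) => [b|//]; rewrite FF'//; apply: below_lt E.
by rewrite /extend /slow /stack rE.
Qed.

(** Recursion along the well-order: the recursive call is defined below [a], and
it is completed by [nil] to the total function that [extend] takes. *)
Definition ladder : G -> nat -> seq G :=
  Fix (@o1wf G) (fun=> nat -> seq G) (fun a g =>
    extend (fun b => if pselect (lt b a) is left p then g b p else fun=> [::]) a).

Lemma ladderE a : ladder a = extend ladder a.
Proof.
rewrite /ladder Fix_eq; last first.
  move=> x f g fg; apply: eq_extend => b bx.
  by case: pselect => // p; rewrite fg.
by apply: eq_extend => b ba; case: pselect.
Qed.

Lemma mem_stack F a k n b :
  b \in stack F a k n <-> exists j c, [/\ j < k, below a j = Some c & b \in F c n].
Proof.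
split=> [/flattenP[s /mapP[j]]|[j [c [jk jc bc]]]].
  rewrite mem_iota /= add0n => jk ->; rewrite /rung.
  by case jc : (below a j) => [c|//] bc; exists j, c.
apply/flattenP; exists (F c n) => //; apply/mapP; exists j.
  by rewrite mem_iota.
by rewrite /rung jc.
Qed.

Lemma slow_spec F a n :
  slow F a n <= n /\
  forall m, n <= m -> slow F a n * size (stack F a (slow F a n) m) <= m.
Proof.
rewrite /slow.
pose P (k : 'I_n.+1) := `[< forall m, n <= m -> k * size (stack F a k m) <= m >].
have P0 : P ord0 by rewrite /P; apply/asboolP.
have [k Pk ->] := @eq_bigmax_cond _ P (fun k : 'I_n.+1 => k : nat)
  (ltac:(by apply/card_gt0P; exists ord0)).
by split; [rewrite -ltnS|move/asboolP: Pk].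
Qed.

Lemma slow_max F a n k : k <= n ->
  (forall m, n <= m -> k * size (stack F a k m) <= m) -> k <= slow F a n.
Proof.
move=> kn kP; have kn' : k < n.+1 by [].
by apply: (@leq_bigmax_cond _ _ _ (Ordinal kn')); apply/asboolP.
Qed.

Lemma slow_mono F a n n' : n <= n' -> slow F a n <= slow F a n'.
Proof.
move=> nn'; have [h1 h2] := slow_spec F a n.
apply: slow_max => [|m n'm]; first exact: leq_trans nn'.
by apply: h2; apply: leq_trans n'm.
Qed.

(** The growth condition s(n) = o(n), stated with integers. It survives the
construction because finite sums of such functions still satisfy it. *)
Definition sublinear_growth (s : nat -> nat) :=
  forall k, exists N, forall n, N <= n -> k * s n <= n.

Lemma sublinear_growthD s t : sublinear_growth s -> sublinear_growth t ->
  sublinear_growth (fun n => s n + t n).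
Proof.
move=> hs ht k; have [N1 h1] := hs k.*2; have [N2 h2] := ht k.*2.
exists (maxn N1 N2) => n; rewrite geq_max => /andP[/h1 + /h2].
by rewrite -!doubleMl -(leq_double (k * _)); lia.
Qed.

(** The first [k] predecessors carry lists of total size o(n), hence may all be
stacked from some level on. *)
Lemma slow_unbounded F a :
    (forall b, lt b a -> sublinear_growth (fun n => size (F b n))) ->
  forall k, exists N, forall n, N <= n -> k <= slow F a n.
Proof.
move=> Fg k.
have : sublinear_growth (fun n => size (stack F a k n)).
  rewrite /stack; elim: k => [|k IH]; first by move=> i; exists 0 => n _; rewrite muln0.
  have -> : (fun n => size (flatten [seq rung F a j n | j <- iota 0 k.+1])) =
      (fun n => size (flatten [seq rung F a j n | j <- iota 0 k]) + size (rung F a k n)).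
    apply/funext => n.
    by rewrite -addn1 iotaD map_cat flatten_cat size_cat /= cats0.
  apply: sublinear_growthD => //.
  rewrite /rung; case ak : (below a k) => [b|].
    by apply: Fg; apply: below_lt ak.
  by move=> i; exists 0 => n _; rewrite muln0.
move=> /(_ k)[N hN]; exists (maxn N k) => n; rewrite geq_max => /andP[Nn kn].
by apply: slow_max => // m nm; apply: hN; apply: leq_trans nm.
Qed.

Lemma ladder_growth a : sublinear_growth (fun n => size (ladder a n)).
Proof.
elim/(well_founded_ind (@o1wf G)): a => a IH k; rewrite ladderE /=.
(* The factor 2 pays for the point [a] itself, added to the stack. *)
have [N hN] := slow_unbounded IH k.*2.
exists (maxn N k.*2) => n; rewrite geq_max => /andP[/hN hk kn].
have [_ /(_ n (leqnn n))] := slow_spec ladder a n.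
set s := size _; have : k.*2 * s <= slow ladder a n * s by rewrite leq_mul2r hk orbT.
by rewrite -/s; lia.
Qed.

(** The bound does not depend on [a]: a limit of lists of bounded level is thus
finite. *)
Lemma ladder_size a n : size (ladder a n) <= n.+1.
Proof.
rewrite ladderE /= ltnS; have [_ /(_ n (leqnn n))] := slow_spec ladder a n.
case: (slow _ _ _) => [|k]; first by [].
by apply: leq_trans; rewrite mulSn leq_addr.
Qed.

Lemma ladder0 a : ladder a 0 = [:: a].
Proof.
rewrite ladderE /extend; have [+ _] := slow_spec ladder a 0.
by rewrite leqn0 => /eqP->.
Qed.

Lemma ladder_self a n : a \in ladder a n.
Proof. by rewrite ladderE inE eqxx. Qed.

Lemma ladder_le a n b : b \in ladder a n -> b = a \/ lt b a.
Proof.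
elim/(well_founded_ind (@o1wf G)): a b => a IH b; rewrite ladderE inE.
move=> /orP[/eqP|/mem_stack[j [c [_ jc bc]]]]; first by left.
have ca := below_lt jc; right; have [->//|bc'] := IH c ca b bc.
exact: o1trans ca.
Qed.

Lemma ladder_mono a n m : n <= m -> {subset ladder a n <= ladder a m}.
Proof.
elim/(well_founded_ind (@o1wf G)): a => a IH nm b; rewrite ladderE !inE.
move=> /orP[->//|/mem_stack[j [c [jk jc bc]]]]; apply/orP; right.
apply/mem_stack; exists j, c; split=> //; last exact: IH (below_lt jc) nm _ bc.
exact: leq_trans jk (slow_mono _ _ nm).
Qed.

Lemma ladder_exhaust a b : lt b a -> exists n, b \in ladder a n.
Proof.
move=> ba; have [j jb] := below_onto ba.
have [N hN] := slow_unbounded (fun c (_ : lt c a) => ladder_growth c) j.+1.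
exists N; rewrite ladderE inE; apply/orP; right; apply/mem_stack.
by exists j, b; split=> //; [apply: hN|apply: ladder_self].
Qed.

(** A stack of lists closed under this property is closed under it. This
coherence makes a limit of lists of growing level an initial segment. *)
Lemma ladder_trans a b n : b \in ladder a n -> {subset ladder b n <= ladder a n}.
Proof.
elim/(well_founded_ind (@o1wf G)): a b => a IH b; rewrite ladderE inE.
move=> /orP[/eqP->|/mem_stack[j [c [jk jc bc]]]] d db; first by rewrite -ladderE.
rewrite inE; apply/orP; right; apply/mem_stack; exists j, c; split=> //.
exact: IH (below_lt jc) _ bc _ db.
Qed.

End Ladder.

(** * The compact set spanned by a ladder *)

Section LadderCompact.
Variable G : omega1.
Local Notation lt := (@o1lt G).

Definition ladder_closure : set (G -> bool) :=
  [set A | forall s : seq G, exists a n, {in s, forall g, A g = (g \in ladder a n)}].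

Lemma ladder_closure_ladder a n : ladder_closure (fun g => g \in ladder a n).
Proof. by move=> s; exists a, n. Qed.

Lemma exists_notin (s : seq G) : exists a, a \notin s.
Proof.
apply: contrapT => /forallNP h; apply: (@o1uncount G).
apply: sub_countable (finite_set_countable (finite_seq s)).
by apply: subset_card_le => a _ /=; have /negP := h a; rewrite negbK.
Qed.

Lemma exists_greatest (P : pred G) (s : seq G) : has P s ->
  exists2 m, P m & {in s, forall g, P g -> g = m \/ lt g m}.
Proof.
elim: s => [//|x s IH] /=.
have [Ps _|nPs] := boolP (has P s); last first.
  rewrite orbF => Px; exists x => // g; rewrite inE => /orP[/eqP|gs Pg].
    by left.
  by case/negP: nPs; apply/hasP; exists g.
have [m Pm mP] := IH Ps.
have [[Px mx]|nx] := pselect (P x /\ lt m x).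
  exists x => // g; rewrite inE => /orP[/eqP|gs Pg]; first by left.
  by right; have [->//|gm] := mP g gs Pg; apply: o1trans mx.
exists m => // g; rewrite inE => /orP[/eqP->|gs] Pg; last exact: mP.
by have [?|?|?] := o1total x m; [right|left|case: nx].
Qed.

Lemma ladder_absorb a (s : seq G) : {in s, forall g, g = a \/ lt g a} ->
  exists N, forall n, (N <= n)%N -> {subset s <= ladder a n}.
Proof.
elim: s => [_|x s IH sa]; first by exists 0%N.
have [|N hN] := IH; first by move=> g gs; apply: sa; rewrite inE gs orbT.
have [M hM] : exists M, x \in ladder a M.
  have [->|/ladder_exhaust//] := sa x (mem_head x s).
  by exists 0%N; apply: ladder_self.
exists (maxn N M) => n; rewrite geq_max => /andP[Nn Mn] g.
rewrite inE => /orP[/eqP->|gs]; first exact: ladder_mono Mn _ hM.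
exact: hN.
Qed.

(** Initial segments are limits of ladders because the ladders of a point
exhaust everything below that point. *)
Lemma ladder_closure_initial (A : G -> bool) :
  (forall a b, lt b a -> A a -> A b) -> ladder_closure A.
Proof.
move=> Adown s; have [/exists_greatest[m Am mP]|nA] := boolP (has A s).
  have [N /(_ N (leqnn N)) hN] := @ladder_absorb m [seq g <- s | A g]
    ltac:(by move=> g; rewrite mem_filter => /andP[Ag gs]; apply: mP).
  exists m, N => g gs; apply/idP/idP => [Ag|/ladder_le[->//|gm]].
    by apply: hN; rewrite mem_filter Ag.
  exact: Adown gm Am.
have [a as_] := exists_notin s; exists a, 0%N => g gs; rewrite ladder0 inE.
transitivity false; first by apply/negP => Ag; case/negP: nA; apply/hasP; exists g.
by apply/esym/negP => /eqP ga; rewrite -ga gs in as_.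
Qed.

(** A list without repetition of maximal size in [A] exhausts [A]. *)
Lemma bounded_finite (A : pred G) N :
    (forall s, uniq s -> all A s -> (size s <= N)%N) ->
  exists s : seq G, forall g, A g = (g \in s).
Proof.
move=> hA; pose P n := `[< exists s, [/\ uniq s, all A s & size s = n] >].
have P0 : exists n, P n by exists 0%N; apply/asboolP; exists [::].
have Pub n : P n -> (n <= N)%N by move=> /asboolP[s [us As <-]]; apply: hA.
case: (ex_maxnP P0 Pub) => n /asboolP[s [us As sn]] nmax.
exists s => g; apply/idP/idP => [Ag|/(allP As)//].
apply: contraT => gs; have : P n.+1.
  by apply/asboolP; exists (g :: s); rewrite /= gs us Ag As sn.
by move=> /nmax; rewrite ltnn.
Qed.

(** A limit of ladders [ladder a n] whose indices [n] are unbounded is closed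
downwards by [ladder_trans]; a limit with bounded indices has boundedly many
elements by [ladder_size]. *)
Lemma ladder_closure_dichotomy (A : G -> bool) : ladder_closure A ->
  (forall a b, lt b a -> A a -> A b) \/
  exists s : seq G, forall g, A g = (g \in s).
Proof.
move=> KA; have [|nd] := pselect (forall a b, lt b a -> A a -> A b); first by left.
right; have [a [b [ba Aa nAb]]] : exists a b, [/\ lt b a, A a & ~ A b].
  apply: contrapT => h; apply: nd => a b ba Aa; apply: contrapT => nAb.
  by apply: h; exists a, b.
have [m bm] := ladder_exhaust ba.
apply: (@bounded_finite _ m) => s us As.
have [c [n cn]] := KA [:: a, b & s].
have ac : a \in ladder c n by rewrite -cn ?Aa// mem_head.
have nbc : b \notin ladder c n.
  by rewrite -cn ?inE ?eqxx ?orbT//; apply/negP.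
have nm : (n < m)%N.
  rewrite ltnNge; apply: contra nbc => mn.
  exact: ladder_trans ac _ (ladder_mono mn bm).
apply: leq_trans nm; apply: leq_trans (ladder_size c n).
apply: uniq_leq_size => // g gs; rewrite -cn; first exact: (allP As).
by rewrite !inE gs !orbT.
Qed.

Lemma near_cylinder (A : {ptws G -> bool}) (s : seq G) :
  \forall A' \near A, {in s, forall g, A' g = A g}.
Proof.
elim: s => [|x s IH]; first by near=> A'.
have xA : \forall A' \near A, A' x = A x.
  apply: (@proj_continuous _ (fun=> bool) x A [set b | b = A x]).
  exact: discrete_set1.
near=> A' => g; rewrite inE => /orP[/eqP->|gs]; first by near: A'.
by apply: (near IH A' _ g gs).
Unshelve. all: by end_near. Qed.

Lemma compact_ladder_closure : compact (ladder_closure : set {ptws G -> bool}).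
Proof.
have cT : compact [set: {ptws G -> bool}].
  have := @tychonoff _ (fun _ : G => _) _ (fun=> bool_compact).
  by congr (compact _); rewrite eqEsubset.
apply: (subclosed_compact _ cT) => // A clA s.
have [A' [KA' A'A]] := clA _ (near_cylinder A s).
have [a [n h]] := KA' s; exists a, n => g gs.
by rewrite -A'A// h.
Qed.

(** Subcovers are indexed by an initial segment of the integers, the form in
which compactness is used for functionals. *)
Lemma ladder_closure_cover (p : nat -> G -> bool) (s : nat -> seq G) :
    (forall A, ladder_closure A -> exists i, {in s i, A =1 p i}) ->
  exists m, forall A, ladder_closure A -> exists2 i, (i < m)%N & {in s i, A =1 p i}.
Proof.
move=> cov; have /compact_near_coveringP cK := compact_ladder_closure.
have [|m _ mP] := cK nat \oo (fun m A => exists2 i, (i < m)%N & {in s i, A =1 p i}) _.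
  move=> A /cov[i Ai].
  exists ([set A' : G -> bool | {in s i, forall g, A' g = A g}], [set m | (i < m)%N]).
    by split; [exact: near_cylinder|exists i.+1].
  move=> [A' m] /= [A'A im]; exists i => // g gs.
  by rewrite A'A// Ai.
by exists m => A KA; apply: (mP m) => //=.
Qed.

Lemma countable_below (a : G) : countable [set b | b = a \/ lt b a].
Proof.
have -> : [set b | b = a \/ lt b a] =
    \bigcup_(t in [set: bool]) (if t then [set a] else [set b | lt b a]).
  apply/seteqP; split=> b /=; first by move=> []; [exists true|exists false].
  by move=> [[] _]; [left|right].
apply: bigcup_countable; first exact: countableP.
by move=> [] _; [apply: countable1|apply: o1count].
Qed.

(** On a countable set, a finite member leaves a finite trace. A proper initial
segment consists of the points below some [m]; it contains the countable set,
or [m] is at most one of its points, and there are countably many such [m]. *)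
Lemma ladder_closure_traces (c : nat -> G) :
  exists e : nat -> G -> bool, (forall i, ladder_closure (e i)) /\
    forall A, ladder_closure A -> exists i, forall j, A (c j) = e i (c j).
Proof.
pose B := \bigcup_j [set b | b = c j \/ lt b (c j)].
have Bc : countable B.
  by apply: bigcup_countable => // j _; exact: countable_below.
have [b [_ bP]] := countable_enum Bc.
(* A name is a finite set of indices of [c], an index of the end [m] of an
   initial segment, or the mark of the segments that contain all [c j]. *)
pose N := (seq nat + option nat)%type.
pose named (w : N) (A : G -> bool) := match w with
  | inl t => forall j, A (c j) = (c j \in map c t)
  | inr None => forall j, A (c j)
  | inr (Some i) => exists2 m, b i = Some m & forall j, A (c j) = lt (c j) m
  end.
have named_ex A : ladder_closure A -> exists w, named w A.
  move=> /ladder_closure_dichotomy[Ad|[s sA]]; last first.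
    suff [t tP] : exists t, forall j, (c j \in s) = (c j \in map c t).
      by exists (inl t) => j; rewrite sA tP.
    elim: {sA} s => [|x s [t tP]]; first by exists [::].
    have [[i ci]|nx] := pselect (exists i, c i = x).
      by exists (i :: t) => j; rewrite /= !inE tP ci.
    exists t => j; rewrite inE tP; case: eqP => // cx.
    by case: nx; exists j.
  have [allA|/existsNP[k nAk]] := pselect (forall j, A (c j)).
    by exists (inr None).
  suff [m nAm mP] : exists2 m, ~ A m & forall x, lt x m -> A x.
    have Bm : B m.
      exists k => //=; have [?|?|km] := o1total m (c k); [by right|by left|].
      by case: nAk; apply: mP.
    have [i bi] := bP m Bm; exists (inr (Some i)), m => // j.
    apply/idP/idP => [Aj|/mP//].
    have [//|E|mj] := o1total (c j) m; first by rewrite E in Aj.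
    by case: nAm; apply: Ad mj Aj.
  move: nAk; elim/(well_founded_ind (@o1wf G)): (c k) => x IH nAx.
  have [h|/existsNP[y /not_implyP[yx nAy]]] := pselect (forall y, lt y x -> A y).
    by exists x.
  exact: IH yx nAy.
have named_inj w A A' : named w A -> named w A' -> forall j, A (c j) = A' (c j).
  case: w => [t|[i|]] /=.
  - by move=> h h' j; rewrite h h'.
  - by move=> [m bi h] [m']; rewrite bi => -[<-] h' j; rewrite h h'.
  - by move=> h h' j; rewrite h h'.
pose spec i (A : G -> bool) := ladder_closure A /\
  forall A', ladder_closure A' ->
    (exists2 w : N, unpickle i = Some w & named w A') ->
    forall j, A' (c j) = A (c j).
have spec_ex i : exists A, spec i A.
  have [[A' [KA' [w iw wA']]]|nA] := pselect (exists A', ladder_closure A' /\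
      exists2 w : N, unpickle i = Some w & named w A').
    exists A'; split=> // A2 KA2 [w2]; rewrite iw => -[<-] wA2.
    exact: named_inj wA2 wA'.
  exists xpredT; split; first exact: ladder_closure_initial.
  by move=> A' KA' hA'; case: nA; exists A'.
have [e eP] := choice spec_ex.
exists e; split=> [i|A KA]; first by have [] := eP i.
have [w wA] := named_ex A KA; exists (pickle w).
by have [_ h] := eP (pickle w); apply: h => //; exists w => //; rewrite pickleK.
Qed.

End LadderCompact.

(** * Real and complex scalars, and the function spaces over them *)

(** What the real field and the complex field have in common as scalar fields
of Banach spaces. In the real case [im] and [iunit] vanish. Norms of vectors
lie in the scalar field, whose order is only partial in the complex case, so
estimates are carried out in [R] through [re]. *)
Record scalars (R : realType) := Scalars {
  sK :> numFieldType;
  emb : {rmorphism R -> sK};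
  re : sK -> R;
  im : sK -> R;
  iunit : sK;
  reD : {morph re : x y / x + y};
  imD : {morph im : x y / x + y};
  re_embM : forall t z, re (emb t * z) = t * re z;
  im_embM : forall t z, im (emb t * z) = t * im z;
  re_emb : cancel emb re;
  ge0_emb : forall t, 0 <= t -> 0 <= emb t;
  emb_re : forall z, 0 <= z -> emb (re z) = z;
  le_re : forall z, `|re z| <= re `|z|;
  le_im : forall z, `|im z| <= re `|z|;
  decomp : forall z, z = emb (re z) + iunit * emb (im z);
  iunit_le1 : `|iunit| <= 1 }.

Definition real_scalars (R : realType) : scalars R.
Proof.
refine (@Scalars R R (idfun : {rmorphism R -> R}) id (fun=> 0) 0
  _ _ _ _ _ _ _ _ _ _ _) => //=.
- by move=> x y; rewrite addr0.
- by move=> t z; rewrite mulr0.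
- by move=> z; rewrite normr0.
- by move=> z; rewrite mul0r addr0.
- by rewrite normr0 ler01.
Defined.

Definition complex_scalars (R : realType) : scalars R.
Proof.
refine (@Scalars R R[i] (real_complex R : {rmorphism R -> R[i]})
  (@complex.Re R) (@complex.Im R) ('i%C : R[i]) _ _ _ _ _ _ _ _ _ _ _).
- by move=> [a b] [c d].
- by move=> [a b] [c d].
- by move=> t [a b] /=; rewrite mul0r subr0.
- by move=> t [a b] /=; rewrite mul0r addr0.
- by [].
- by move=> t t0; rewrite lecE /= eqxx.
- by move=> z z0; exact: RRe_real (ger0_real z0).
- by move=> z; have := normc_ge_Re z; rewrite lecE /= => /andP[].
- move=> [a b]; rewrite normc_def /= -sqrtr_sqr ler_wsqrtr// lerDr sqr_ge0//.
- exact: complexE.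
- by rewrite normc_def /= expr0n add0r expr1n sqrtr1.
Defined.

Section ScalarTheory.
Context {R : realType} {K : scalars R}.
Implicit Types (s t : R) (z : K).

Lemma re_ge0 z : 0 <= z -> 0 <= re z.
Proof.
by move=> z0; have := le_re z; rewrite (ger0_norm z0); apply: le_trans.
Qed.

Lemma emb_le s t : (emb K s <= emb K t) = (s <= t).
Proof.
apply/idP/idP => [|st]; last by rewrite -subr_ge0 -rmorphB ge0_emb// subr_ge0.
by rewrite -subr_ge0 -rmorphB => /re_ge0; rewrite re_emb subr_ge0.
Qed.

Lemma emb_inj : injective (emb K).
Proof. exact: can_inj (@re_emb _ _). Qed.

Lemma emb_lt s t : (emb K s < emb K t) = (s < t).
Proof. by rewrite !lt_neqAle emb_le (inj_eq emb_inj). Qed.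

Lemma norm_emb t : `|emb K t| = emb K `|t|.
Proof.
have [t0|t0] := leP 0 t; first by rewrite !ger0_norm ?ge0_emb.
by rewrite (ltr0_norm t0) -normrN -rmorphN ger0_norm// ge0_emb// oppr_ge0 ltW.
Qed.

Lemma re0 : re (0 : K) = 0.
Proof. by rewrite -(rmorph0 (emb K)) re_emb. Qed.

Lemma re1 : re (1 : K) = 1.
Proof. by rewrite -(rmorph1 (emb K)) re_emb. Qed.

Lemma reN : {morph @re R K : z / - z}.
Proof. by move=> z; rewrite -mulN1r -(rmorphN1 (emb K)) re_embM mulN1r. Qed.

Lemma imN : {morph @im R K : z / - z}.
Proof. by move=> z; rewrite -mulN1r -(rmorphN1 (emb K)) im_embM mulN1r. Qed.

Lemma reB : {morph @re R K : x y / x - y}.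
Proof. by move=> x y; rewrite reD reN. Qed.

Lemma imB : {morph @im R K : x y / x - y}.
Proof. by move=> x y; rewrite imD imN. Qed.

Lemma re_emb_norm z : emb K (re `|z|) = `|z|.
Proof. exact: emb_re. Qed.

Lemma re_le x y : x <= y -> re x <= re (y : K).
Proof. by rewrite -subr_ge0 => /re_ge0; rewrite reB subr_ge0. Qed.

Lemma re_normM x y : re `|x * y : K| = re `|x| * re `|y|.
Proof. by rewrite normrM -re_emb_norm re_embM re_emb. Qed.

Lemma le_re_im z : re `|z| <= `|re z| + `|im z|.
Proof.
rewrite -emb_le re_emb_norm rmorphD {1}(decomp z).
apply: le_trans (ler_normD _ _) _; rewrite norm_emb lerD2l normrM norm_emb.
by rewrite ler_piMl ?ge0_emb// iunit_le1.
Qed.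

Lemma real_re z : z \is Num.real -> emb K (re z) = z.
Proof.
rewrite realE => /orP[/emb_re//|z0].
by apply: oppr_inj; rewrite -rmorphN -reN emb_re// oppr_ge0.
Qed.

Lemma re_gt0 z : 0 < z -> 0 < re z.
Proof. by move=> z0; rewrite -emb_lt rmorph0 emb_re// ltW. Qed.

Lemma emb_gt0 t : (0 < emb K t) = (0 < t).
Proof. by rewrite -emb_lt rmorph0. Qed.

End ScalarTheory.

Section RNorm.
Context {R : realType} {K : scalars R} {V : normedZmodType K}.
Implicit Types x y : V.

Definition rnorm x : R := re `|x|.

Lemma emb_rnorm x : emb K (rnorm x) = `|x|.
Proof. exact: emb_re. Qed.

Lemma rnorm_ge0 x : 0 <= rnorm x.
Proof. exact: re_ge0. Qed.

Lemma rnormD x y : rnorm (x + y) <= rnorm x + rnorm y.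
Proof. by rewrite /rnorm -reD re_le// ler_normD. Qed.

Lemma rnormN x : rnorm (- x) = rnorm x.
Proof. by rewrite /rnorm normrN. Qed.

Lemma rnorm_distrC x y : rnorm (x - y) = rnorm (y - x).
Proof. by rewrite /rnorm distrC. Qed.

Lemma le_rnorm x (t : R) : (`|x| <= emb K t) = (rnorm x <= t).
Proof. by rewrite -emb_rnorm emb_le. Qed.

Lemma lt_rnorm x (t : R) : (`|x| < emb K t) = (rnorm x < t).
Proof. by rewrite -emb_rnorm emb_lt. Qed.

End RNorm.

Lemma rnormZ (R : realType) (K : scalars R) (V : normedModType K) (a : K) (x : V) :
  rnorm (a *: x) = re `|a| * rnorm x.
Proof. by rewrite /rnorm normrZ -(re_emb_norm a) re_embM re_emb. Qed.

Section Limits.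
Context {R : realType} {K : scalars R} {V : normedModType K}.

Lemma nbhs_rnorm (x : V) (P : set V) :
  nbhs x P <-> exists2 e : R, 0 < e & forall y, rnorm (x - y) < e -> P y.
Proof.
split=> [/nbhs_normP[e /= e0 h]|[e e0 h]].
  exists (re e) => [|y xy]; first exact: re_gt0.
  by apply: h; rewrite /= -(emb_re (ltW e0)) lt_rnorm.
apply/nbhs_normP; exists (emb K e); first by rewrite /= emb_gt0.
by move=> y /=; rewrite lt_rnorm; apply: h.
Qed.

Lemma cvg_rnorm (T : Type) (F : set_system T) (FF : Filter F) (f : T -> V) (y : V) :
  f @ F --> y <-> forall e : R, 0 < e -> \forall t \near F, rnorm (y - f t) <= e.
Proof.
split=> [/cvgrPdist_le h e e0|h].
  by apply: filterS (h (emb K e) _); rewrite ?emb_gt0// => t; rewrite le_rnorm.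
apply/cvgrPdist_le => e e0; apply: filterS (h (re e) (re_gt0 e0)) => t.
by rewrite -{2}(emb_re (ltW e0)) le_rnorm.
Qed.

Lemma cauchy_rnorm (F : set_system V) (FF : ProperFilter F) :
  cauchy F -> forall e : R, 0 < e -> exists x : V, F [set y | rnorm (x - y) < e].
Proof.
move=> /cauchyP h e e0; have [|x Fx] := h (emb K e); first by rewrite emb_gt0.
exists x; apply: filterS Fx => y; rewrite -ball_normE /=.
by rewrite lt_rnorm.
Qed.

Lemma rnorm_cauchy (F : set_system V) (FF : ProperFilter F) :
  (forall e : R, 0 < e -> exists x : V, F [set y | rnorm (x - y) < e]) -> cauchy F.
Proof.
move=> h; apply/cauchyP => e e0; have [x Fx] := h (re e) (re_gt0 e0).
exists x; apply: filterS Fx => y; rewrite -ball_normE /=.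
by rewrite -{2}(emb_re (ltW e0)) lt_rnorm.
Qed.

End Limits.

Lemma bounded_additive_continuous (R : realType) (K : scalars R)
    (V W : normedModType K) (f : V -> W) (M : R) :
  (forall u v, f (u - v) = f u - f v) ->
  (forall x, rnorm (f x) <= M * rnorm x) -> continuous f.
Proof.
move=> fB fM x; apply/(@cvg_rnorm _ _ _ _ (nbhs x)) => t t0.
have M1 : 0 < `|M| + 1 by rewrite ltr_wpDl.
apply/nbhs_rnorm; exists (t / (`|M| + 1)) => [|y]; first by rewrite divr_gt0.
rewrite ltr_pdivlMr// -fB => xy.
apply: le_trans (fM _) _; apply: le_trans (ltW xy); rewrite mulrC.
rewrite ler_wpM2l ?rnorm_ge0//; apply: le_trans (ler_norm M) _.
by rewrite lerDl.
Qed.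

Section CompleteScalars.
Context {R : realType} {K : scalars R}.

(** Real and imaginary parts converge separately by completeness of [R]. *)
Lemma scalars_complete (F : set_system K^o) (FF : ProperFilter F) :
  cauchy F -> cvg F.
Proof.
move=> cF.
have part (p : K -> R) : {morph p : x y / x - y} -> (forall z : K, `|p z| <= re `|z|) ->
    exists a, p @ F --> (a : R).
  move=> pB ple; have /cvg_ex[a] : cvg (p @ F); last by exists a.
  apply/cauchy_cvgP/cauchyP => e e0; have [x Fx] := cauchy_rnorm FF cF e0.
  exists (p x); suff: F (p @^-1` ball (p x) e) by [].
  apply: filterS Fx => y /= xy; rewrite -ball_normE /= -pB.
  by apply: le_lt_trans xy; apply: ple.
have [a Fa] := part (@re R K) reB (@le_re _ _).
have [b Fb] := part (@im R K) imB (@le_im _ _).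
apply/cvg_ex; exists (emb K a + iunit K * emb K b).
apply/(@cvg_rnorm _ _ _ _ _ _ id) => e e0; near=> z.
have az : `|a - re z| <= e / 2.
  by near: z; move/cvgrPdist_le : Fa; apply; rewrite divr_gt0.
have bz : `|b - im z| <= e / 2.
  by near: z; move/cvgrPdist_le : Fb; apply; rewrite divr_gt0.
rewrite {1}(decomp z) /rnorm opprD addrACA -mulrBr -!rmorphB.
rewrite [leRHS]splitr; apply: le_trans (rnormD _ _) _; apply: lerD.
  by rewrite /rnorm norm_emb re_emb.
rewrite /rnorm re_normM norm_emb re_emb; apply: le_trans bz.
rewrite ler_piMl//; by have := re_le (iunit_le1 K); rewrite re1.
Unshelve. all: by end_near. Qed.

End CompleteScalars.

Section BoundedFunctions.
Context {R : realType} (K : scalars R) (T : Type).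

Definition bounded_pred : pred (T -> K^o) :=
  fun f => `[< exists M : R, forall t, rnorm (f t) <= M >].

Record linf := Linf { linf_fun :> T -> K^o; _ : bounded_pred linf_fun }.
HB.instance Definition _ := [isSub for linf_fun].
HB.instance Definition _ := [Choice of linf by <:].

Lemma bounded_closed : GRing.subsemimod_closed bounded_pred.
Proof.
split=> [|a f]; first split.
- apply/asboolP; exists 0 => t; by rewrite /rnorm normr0 re0.
- move=> f g /asboolP[M fM] /asboolP[N gN]; apply/asboolP; exists (M + N) => t.
  by apply: le_trans (rnormD _ _) _; apply: lerD.
- move=> /asboolP[M fM]; apply/asboolP; exists (re `|a| * M) => t.
  by rewrite rnormZ ler_wpM2l ?re_ge0.
Qed.

HB.instance Definition _ :=
  GRing.SubChoice_isSubLmodule.Build K (T -> K^o) bounded_pred linf bounded_closed.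

Lemma linfD (f g : linf) t : (f + g) t = f t + g t.
Proof. by []. Qed.

Lemma linfN (f : linf) t : (- f) t = - f t.
Proof. by []. Qed.

Lemma linfB (f g : linf) t : (f - g) t = f t - g t.
Proof. by []. Qed.

Lemma linfZ a (f : linf) t : (a *: f) t = a * f t.
Proof. by []. Qed.

Definition linf_sup (f : linf) : R := sup [set rnorm (f t) | t in setT].

Lemma linf_has_ub (f : linf) : has_ubound [set rnorm (f t) | t in setT].
Proof.
have /asboolP[M fM] := valP f; exists M => _ [t _ <-]; exact: fM.
Qed.

Lemma le_linf_sup (f : linf) t : rnorm (f t) <= linf_sup f.
Proof. by apply: ub_le_sup; [exact: linf_has_ub|exists t]. Qed.

Lemma linf_sup_le (f : linf) M : 0 <= M -> (forall t, rnorm (f t) <= M) ->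
  linf_sup f <= M.
Proof.
move=> M0 fM; rewrite /linf_sup.
have [->|ne] := eqVneq [set rnorm (f t) | t in setT] set0; first by rewrite sup0.
by apply: ge_sup; [apply/set0P|move=> _ [t _ <-]].
Qed.

Lemma linf_sup_ge0 (f : linf) : 0 <= linf_sup f.
Proof.
rewrite /linf_sup.
have [->|/set0P[_ [t _ _]]] := eqVneq [set rnorm (f t) | t in setT] set0.
  by rewrite sup0.
exact: le_trans (rnorm_ge0 _) (le_linf_sup f t).
Qed.

Let norm_linf (f : linf) : K := emb K (linf_sup f).

Let normD (f g : linf) : norm_linf (f + g) <= norm_linf f + norm_linf g.
Proof.
rewrite -rmorphD emb_le; apply: linf_sup_le; first by rewrite addr_ge0// linf_sup_ge0.
by move=> t; apply: le_trans (rnormD _ _) _; apply: lerD; apply: le_linf_sup.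
Qed.

Let le_normZ (a : K) (f : linf) : linf_sup (a *: f) <= re `|a| * linf_sup f.
Proof.
apply: linf_sup_le => [|t]; first by rewrite mulr_ge0 ?linf_sup_ge0 ?re_ge0.
by rewrite rnormZ ler_wpM2l ?re_ge0 ?le_linf_sup.
Qed.

Let normZ (a : K) (f : linf) : norm_linf (a *: f) = `|a| * norm_linf f.
Proof.
rewrite -(re_emb_norm a) -rmorphM; congr (emb K _); apply/eqP; rewrite eq_le le_normZ/=.
have [->|a0] := eqVneq a 0.
  by rewrite normr0 re0 mul0r linf_sup_ge0.
have a0' : 0 < re `|a| by rewrite re_gt0// normr_gt0.
rewrite -ler_pdivlMl//; apply: le_trans (_ : linf_sup (a^-1 *: (a *: f)) <= _).
  by rewrite scalerA mulVf// scale1r.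
have -> : (re `|a|)^-1 = re `|a^-1|.
  apply: (mulIf (lt0r_neq0 a0')); rewrite mulVf ?lt0r_neq0// -re_normM mulVf//.
  by rewrite normr1 re1.
exact: le_normZ.
Qed.

Let norm0_eq0 (f : linf) : norm_linf f = 0 -> f = 0.
Proof.
rewrite -(rmorph0 (emb K)) => /emb_inj f0; apply: val_inj; apply/funext => t.
apply/eqP; rewrite -normr_eq0 -emb_rnorm -(rmorph0 (emb K)) (inj_eq emb_inj).
by rewrite eq_le rnorm_ge0 andbT -f0 le_linf_sup.
Qed.

HB.instance Definition _ :=
  @Lmodule_isNormed.Build K linf norm_linf normD normZ norm0_eq0.

Lemma rnorm_linf (f : linf) : rnorm f = linf_sup f.
Proof. exact: re_emb. Qed.

Lemma le_linf (f : linf) t : rnorm (f t) <= rnorm f.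
Proof. by rewrite rnorm_linf le_linf_sup. Qed.

Lemma linf_le (f : linf) M : 0 <= M -> (forall t, rnorm (f t) <= M) ->
  rnorm f <= M.
Proof. by rewrite rnorm_linf; apply: linf_sup_le. Qed.

(** Pointwise limits, which are uniform because the Cauchy condition is. *)
Lemma linf_complete (F : set_system linf) (FF : ProperFilter F) :
  cauchy F -> cvg F.
Proof.
move=> cF.
have lim_ex t : exists a : K^o, (fun f : linf => f t) @ F --> a.
  apply/cvg_ex; apply: scalars_complete; apply: rnorm_cauchy => e e0.
  have [f Ff] := cauchy_rnorm FF cF e0; exists (f t).
  suff: F ((fun g : linf => g t) @^-1` [set y | rnorm (f t - y) < e]) by [].
  by apply: filterS Ff => g /=; apply: le_lt_trans; rewrite -linfB le_linf.
have [g gF] := choice lim_ex.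
have approx e : 0 < e -> exists2 f0 : linf, F [set f | rnorm (f0 - f) <= e] &
    forall t, rnorm (f0 t - g t) <= e + e.
  move=> e0; have [f0 Ff0] := cauchy_rnorm FF cF e0; exists f0.
    by apply: filterS Ff0 => f /ltW.
  move=> t; have /cvg_rnorm /(_ e e0) Fg := gF t.
  have [f [/= f0f ft]] := filter_ex (filterI Ff0 Fg).
  have -> : f0 t - g t = (f0 - f) t - (g t - f t).
    by rewrite linfB opprB addrA subrK.
  apply: le_trans (rnormD _ _) _; apply: lerD; last by rewrite rnormN.
  by apply: le_trans (le_linf _ _) (ltW f0f).
have gb : bounded_pred g.
  have [f0 _ f0g] := approx 1 ltr01; apply/asboolP.
  exists (1 + 1 + rnorm f0) => t; rewrite -[g t](subrK (f0 t)).
  apply: le_trans (rnormD _ _) _; apply: lerD; last exact: le_linf.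
  by rewrite rnorm_distrC.
apply/cvg_ex; exists (Linf gb); apply/(@cvg_rnorm _ _ _ _ _ _ id) => e e0.
have e3 : 0 < e / 3 by rewrite divr_gt0.
have [f0 Ff0 f0g] := approx _ e3; apply: filterS Ff0 => f /= f0f.
rewrite -[Linf gb](subrK f0) -addrA; apply: le_trans (rnormD _ _) _.
have -> : e = (e / 3 + e / 3) + e / 3 by field.
apply: lerD => //; apply: linf_le => [|t]; first by rewrite addr_ge0// ltW.
by rewrite linfB rnorm_distrC.
Qed.

HB.instance Definition _ := Uniform_isComplete.Build linf linf_complete.

End BoundedFunctions.

(** * Closed subspaces and underlying real spaces *)

Record closed_subspace (K : numFieldType) (E : normedModType K) := ClosedSubspace {
  cs_set :> set E;
  cs_closed : closed cs_set;
  cs_0 : cs_set 0;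
  cs_D : forall x y, cs_set x -> cs_set y -> cs_set (x + y);
  cs_Z : forall a x, cs_set x -> cs_set (a *: x) }.

Section ClosedSubspaceType.
Context {K : numFieldType} {E : completeNormedModType K} (Y : closed_subspace E).

Definition cs_pred : pred E := fun x => `[< cs_set Y x >].
Record cs_type := CsType { cs_val : E; _ : cs_pred cs_val }.
HB.instance Definition _ := [isSub for cs_val].
HB.instance Definition _ := [Choice of cs_type by <:].

Lemma cs_pred_closed : GRing.subsemimod_closed cs_pred.
Proof.
split=> [|a x /asboolP Yx]; last exact/asboolP/cs_Z.
split; first exact/asboolP/cs_0.
by move=> x y /asboolP Yx /asboolP Yy; apply/asboolP/cs_D.
Qed.

HB.instance Definition _ :=
  GRing.SubChoice_isSubLmodule.Build K E cs_pred cs_type cs_pred_closed.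

Lemma cs_valP (x : cs_type) : cs_set Y (cs_val x).
Proof. by have /asboolP := valP x. Qed.

Definition cs_in (x : E) (Yx : cs_set Y x) : cs_type := CsType (asboolT Yx).

Let cs_norm (x : cs_type) : K := `|cs_val x|.

Let cs_normD (x y : cs_type) : cs_norm (x + y) <= cs_norm x + cs_norm y.
Proof. exact: ler_normD. Qed.

Let cs_normZ (a : K) (x : cs_type) : cs_norm (a *: x) = `|a| * cs_norm x.
Proof. exact: normrZ. Qed.

Let cs_norm0 (x : cs_type) : cs_norm x = 0 -> x = 0.
Proof. by move=> x0; apply: val_inj; exact: normr0_eq0. Qed.

HB.instance Definition _ :=
  @Lmodule_isNormed.Build K cs_type cs_norm cs_normD cs_normZ cs_norm0.

Lemma cs_valD (x y : cs_type) : cs_val (x + y) = cs_val x + cs_val y.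
Proof. by []. Qed.

Lemma cs_valN (x : cs_type) : cs_val (- x) = - cs_val x.
Proof. by []. Qed.

Lemma cs_valZ a (x : cs_type) : cs_val (a *: x) = a *: cs_val x.
Proof. by []. Qed.

Lemma cs_normE (x : cs_type) : `|x| = `|cs_val x|.
Proof. by []. Qed.

Lemma cs_complete (F : set_system cs_type) (FF : ProperFilter F) :
  cauchy F -> cvg F.
Proof.
move=> /cauchyP cF.
have /cvg_ex[l Fl] : cvg (cs_val @ F).
  apply/cauchy_cvgP/cauchyP => e e0; have [x Fx] := cF e e0.
  exists (cs_val x); suff: F (cs_val @^-1` ball (cs_val x) e) by [].
  by apply: filterS Fx => y; rewrite -!ball_normE.
have Yl : cs_set Y l.
  apply: (closed_cvg _ (@cs_closed _ _ Y) _ _ Fl).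
  by apply: filterE => x; apply: cs_valP.
apply/cvg_ex; exists (cs_in Yl); apply/(@cvgrPdist_le _ _ _ _ _ id) => e e0.
by move/cvgrPdist_le : Fl => /(_ e e0).
Qed.

HB.instance Definition _ := Uniform_isComplete.Build cs_type cs_complete.

Lemma cs_val_continuous : continuous (cs_val : cs_type -> E).
Proof.
move=> x; apply/(@cvgrPdist_lt _ _ _ (nbhs x)) => t t0.
by apply/(@nbhs_normP _ cs_type); exists t.
Qed.

End ClosedSubspaceType.

Section Realification.
Context {R : realType} {K : scalars R}.

(** Convexity and differentiability only concern the underlying real space, and
there the scalar field is totally ordered and the Baire theorem is at hand. *)
Definition realify (X : completeNormedModType K) : Type := X.

Variable X : completeNormedModType K.
Local Notation XR := (realify X).

HB.instance Definition _ := GRing.Zmodule.on XR.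

Let rscale (t : R) (x : XR) : XR := emb K t *: (x : X).

Let rscaleA t u x : rscale t (rscale u x) = rscale (t * u) x.
Proof. by rewrite /rscale scalerA rmorphM. Qed.

Let rscale1 : left_id 1 rscale.
Proof. by move=> x; rewrite /rscale rmorph1 scale1r. Qed.

Let rscaleDr : right_distributive rscale +%R.
Proof. by move=> t x y; apply: scalerDr. Qed.

Let rscaleDl x : {morph rscale^~ x : t u / t + u}.
Proof. by move=> t u; rewrite /rscale rmorphD scalerDl. Qed.

HB.instance Definition _ :=
  GRing.Zmodule_isLmodule.Build R XR rscaleA rscale1 rscaleDr rscaleDl.

Lemma realify_scaleE (t : R) (x : XR) : t *: x = emb K t *: (x : X).
Proof. by []. Qed.

Let rnormX (x : XR) : R := rnorm (x : X).

Let rnormXD (x y : XR) : rnormX (x + y) <= rnormX x + rnormX y.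
Proof. exact: rnormD. Qed.

Let rnormXZ (t : R) (x : XR) : rnormX (t *: x) = `|t| * rnormX x.
Proof. by rewrite /rnormX rnormZ norm_emb re_emb. Qed.

Let rnormX0 (x : XR) : rnormX x = 0 -> x = 0.
Proof.
move=> x0; apply/eqP; rewrite -(@normr_eq0 _ X) -emb_rnorm.
by rewrite -[rnorm _]/(rnormX x) x0 rmorph0.
Qed.

HB.instance Definition _ :=
  @Lmodule_isNormed.Build R XR rnormX rnormXD rnormXZ rnormX0.

Lemma realify_normE (x : XR) : `|x| = rnorm (x : X).
Proof. by []. Qed.

Lemma nbhs_realify (x : X) (P : set X) : nbhs (x : XR) P <-> nbhs x P.
Proof.
split=> [/(@nbhs_normP _ XR)[e /= e0 h]|/nbhs_rnorm[e e0 h]].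
  by apply/nbhs_rnorm; exists e => // y xy; apply: h.
by apply/(@nbhs_normP _ XR); exists e => // y; apply: h.
Qed.

Lemma realify_complete (F : set_system XR) (FF : ProperFilter F) :
  cauchy F -> cvg F.
Proof.
move=> /cauchyP cF.
have /cvg_ex[l /(@cvg_rnorm _ _ _ _ _ _ id) Fl] : cvg (F : set_system X).
  apply/cauchy_cvgP; apply: rnorm_cauchy => e e0; have [x Fx] := cF e e0.
  by exists x; apply: filterS Fx => y; rewrite -ball_normE.
by apply/cvg_ex; exists (l : XR); apply/(@cvgrPdist_le _ _ _ _ _ id) => e /Fl.
Qed.

HB.instance Definition _ := Uniform_isComplete.Build XR realify_complete.

End Realification.

(** * The Hahn-Banach theorem for sublinear functionals *)

Section HahnBanach.
Context {R : realType} {V : lmodType R}.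
Implicit Types (p q : V -> R) (x y : V).

Definition sublinear p :=
  (forall x y, p (x + y) <= p x + p y) /\
  (forall t x, 0 < t -> p (t *: x) <= t * p x).

Lemma sublinear0 p : sublinear p -> p 0 = 0.
Proof.
move=> [pD pZ]; apply/eqP; rewrite eq_le; apply/andP; split.
  have := pZ (2^-1) 0; rewrite scaler0 invr_gt0 ltr0n => /(_ isT); lra.
by have := pD 0 0; rewrite addr0; lra.
Qed.

Lemma sublinear_ge p x : sublinear p -> - p (- x) <= p x.
Proof.
by move=> sp; have := sp.1 x (- x); rewrite subrr sublinear0//; lra.
Qed.

Lemma le_infD (A B : set R) c : A !=set0 -> B !=set0 ->
  (forall a b, A a -> B b -> c <= a + b) -> c <= inf A + inf B.
Proof.
move=> A0 B0 h; rewrite -lerBlDr; apply: lb_le_inf => // a Aa.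
rewrite lerBlDr addrC -lerBlDr; apply: lb_le_inf => // b Bb.
by rewrite lerBlDr addrC; apply: h.
Qed.

(** A functional that is minimal among the sublinear ones is additive: for
every [y], the infimum of [q (x + t y) - t q y] over [t >= 0] is a sublinear
functional of [x] below [q], hence equal to [q], and [t = 1] gives
[q x + q y <= q (x + y)]. *)
Lemma minimal_sublinear_additive q : sublinear q ->
    (forall q', sublinear q' -> (forall x, q' x <= q x) -> q' = q) ->
  forall x y, q (x + y) = q x + q y.
Proof.
move=> sq qmin x y.
pose A z := [set q (z + t *: y) - t * q y | t in [set t | 0 <= t]].
have A0 z : A z !=set0 by exists (q (z + 0 *: y) - 0 * q y); exists 0 => /=.
have Alb z : lbound (A z) (- q (- z)).
  move=> _ [t /= t0 <-].
  have := sq.1 (z + t *: y) (- z); rewrite addrAC subrr add0r => h.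
  have : q (t *: y) >= t * q y.
    move: t0; rewrite le_eqVlt => /orP[/eqP<-|t0].
      by rewrite scale0r sublinear0// mul0r.
    have := sq.2 t^-1 (t *: y); rewrite invr_gt0 => /(_ t0).
    by rewrite scalerA mulVf ?lt0r_neq0// scale1r mulrC ler_pdivlMr// mulrC.
  by lra.
have infle z t : 0 <= t -> inf (A z) <= q (z + t *: y) - t * q y.
  by move=> t0; apply: ge_inf; [exists (- q (- z))|exists t].
have sinf : sublinear (fun z => inf (A z)).
  split=> [z z'|t z t0].
    apply: le_infD => // _ _ [s /= s0 <-] [s' /= s'0 <-].
    apply: le_trans (infle (z + z') (s + s') (addr_ge0 s0 s'0)) _.
    have := sq.1 (z + s *: y) (z' + s' *: y).
    by rewrite addrACA -scalerDl mulrDl; lra.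
  rewrite -ler_pdivrMl//; apply: lb_le_inf => // _ [s /= s0 <-].
  rewrite ler_pdivrMl//; apply: le_trans (infle _ (t * s) _) _.
    by rewrite mulr_ge0// ltW.
  by rewrite -scalerA -scalerDr mulrBr -mulrA lerD2r; apply: sq.2.
have infE z : inf (A z) = q z.
  apply: (congr1 (fun g => g z) (qmin _ sinf _)) => {}z.
  by have := infle z 0 (lexx 0); rewrite scale0r addr0 mul0r subr0.
have := infle x 1 ler01; rewrite infE scale1r mul1r.
by move=> h; apply/eqP; rewrite eq_le sq.1; move: h; lra.
Qed.

Lemma additive_sublinear_homogeneous q : sublinear q ->
    (forall x y, q (x + y) = q x + q y) ->
  forall t x, q (t *: x) = t * q x.
Proof.
move=> sq qD.
have qN x : q (- x) = - q x.
  by have := qD x (- x); rewrite subrr sublinear0//; lra.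
have qZ t x : 0 < t -> q (t *: x) = t * q x.
  move=> t0; apply/eqP; rewrite eq_le sq.2//=.
  by rewrite -lerN2 -mulrN -!qN -scalerN sq.2.
move=> t x; have [t0|t0|->] := ltgtP t 0; last by rewrite scale0r sublinear0// mul0r.
  by rewrite -[t in LHS]opprK scaleNr qN qZ ?oppr_gt0// mulNr opprK.
exact: qZ.
Qed.

(** Zorn's lemma provides a minimal sublinear functional below [p]: a chain of
them has its pointwise infimum as a lower bound, finite since
[- p (- x) <= q x]. *)
Theorem hahn_banach p : sublinear p ->
  exists phi : V -> R, [/\ forall x y, phi (x + y) = phi x + phi y,
    forall t x, phi (t *: x) = t * phi x & forall x, phi x <= p x].
Proof.
move=> sp.
pose S := {q : V -> R | sublinear q /\ forall x, q x <= p x}.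
pose ge (q q' : S) := `[< forall x, sval q' x <= sval q x >].
have [|q1 q2 q3 /asboolP h1 /asboolP h2|q1 q2 /asboolP h1 /asboolP h2|C Ctot|q qmin] :=
    @Zorn S ge.
- by move=> q; apply/asboolP.
- by apply/asboolP => x; apply: le_trans (h1 x).
- case: q1 q2 h1 h2 => [q1 p1] [q2 p2] /= h1 h2.
  have E : q1 = q2 by apply/funext => x; apply/eqP; rewrite eq_le h1 h2.
  by subst q2; congr exist; apply: Prop_irrelevance.
- have [[q0 Cq0]|nC] := pselect (C !=set0); last first.
    exists (exist _ p (conj sp (fun x => lexx (p x)))) => s Cs.
    by case: nC; exists s.
  pose A x := [set sval q x | q in C].
  have A0 x : A x !=set0 by exists (sval q0 x); exists q0.
  have Alb x : has_lbound (A x).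
    exists (- p (- x)) => _ [q _ <-]; have [sq qp] := svalP q.
    by apply: le_trans (sublinear_ge x sq); rewrite lerN2.
  have infle x (q : S) : C q -> inf (A x) <= sval q x.
    by move=> Cq; apply: ge_inf => //; exists q.
  have sinf : sublinear (fun x => inf (A x)).
    split=> [x y|t x t0].
      apply: le_infD => // _ _ [q Cq <-] [q' Cq' <-].
      have [/asboolP qq'|/asboolP qq'] := Ctot _ _ Cq Cq'.
        apply: le_trans (infle _ _ Cq') _; apply: le_trans ((svalP q').1.1 x y) _.
        by rewrite lerD2r.
      apply: le_trans (infle _ _ Cq) _; apply: le_trans ((svalP q).1.1 x y) _.
      by rewrite lerD2l.
    rewrite -ler_pdivrMl//; apply: lb_le_inf => // _ [q Cq <-].
    rewrite ler_pdivrMl//; apply: le_trans (infle _ _ Cq) _.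
    exact: (svalP q).1.2.
  have infp x : inf (A x) <= p x.
    by apply: le_trans (infle x q0 Cq0) _; exact: (svalP q0).2.
  exists (exist _ (fun x => inf (A x)) (conj sinf infp)) => q Cq.
  by apply/asboolP => x /=; apply: infle.
have [sq qp] := svalP q; have qD := @minimal_sublinear_additive (sval q) sq.
have {}qD : forall x y, sval q (x + y) = sval q x + sval q y.
  apply: qD => q' sq' q'q.
  have q'p x : q' x <= p x by apply: le_trans (q'q x) _.
  have /qmin <- // : ge q (exist _ q' (conj sq' q'p)) by apply/asboolP.
exists (sval q); split=> //; exact: additive_sublinear_homogeneous.
Qed.

End HahnBanach.

(** * Subgradients *)

Section Subgradient.
Context {R : realType} {E V : normedModType R}.
Variable hat : E -> V.
Hypothesis hatD : forall x y, hat (x + y) = hat x + hat y.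
Hypothesis hatZ : forall t x, hat (t *: x) = t *: hat x.
Hypothesis hat_ge : forall x, `|x| <= 2 * `|hat x|.

Definition convex_on (U : set E) (f : E -> R) : Prop :=
  forall (x y : E) (t : R), U x -> U y -> 0 <= t -> t <= 1 ->
    U (t *: x + (1 - t) *: y) /\
    f (t *: x + (1 - t) *: y) <= t * f x + (1 - t) * f y.

(** By convexity, a steep descent in the direction [h] would force a steep ascent
in the opposite direction, where [f] is bounded above near [x]. *)
Lemma convex_quotient_ge (U : set E) f x (r : R) : convex_on U f -> 0 < r ->
    (forall y, `|y - x| < r -> U y /\ f y <= f x + 1) ->
  forall s h, 0 < s -> U (x + s *: h) ->
  - (2 / r * `|h|) <= (f (x + s *: h) - f x) / s.
Proof.
move=> cf r0 fr s h s0 Uy.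
have [->|h0] := eqVneq h 0.
  by rewrite scaler0 addr0 subrr mul0r normr0 mulr0 oppr0.
have nh : 0 < `|h| by rewrite normr_gt0.
(* [x] lies on the segment from [x + s *: h] to [x - a *: h], a point of the
   ball where [f] is at most [f x + 1]. *)
set a := r / (2 * `|h|); have a0 : 0 < a by rewrite divr_gt0// mulr_gt0.
have [Uz fz] : U (x - a *: h) /\ f (x - a *: h) <= f x + 1.
  apply: fr; rewrite addrAC subrr add0r normrN normrZ gtr0_norm//.
  have -> : a * `|h| = r / 2 by rewrite /a; field; rewrite gt_eqF.
  by lra.
have as0 : 0 < a + s by rewrite addr_gt0.
pose t := a / (a + s).
have t0 : 0 < t by rewrite divr_gt0.
have tE : 1 - t = s / (a + s).
  by rewrite -[1](@divff _ (a + s)) ?gt_eqF// -mulrBl addrAC subrr add0r.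
have t1 : t <= 1 by rewrite -subr_ge0 tE divr_ge0// ltW.
have [_] := cf _ _ t Uy Uz (ltW t0) t1.
have -> : t *: (x + s *: h) + (1 - t) *: (x - a *: h) = x.
  rewrite !scalerDr addrACA -scalerDl [t + _]addrC subrK scale1r scalerN !scalerA.
  have -> : (1 - t) * a = t * s by rewrite tE /t; field; rewrite gt_eqF.
  by rewrite subrr addr0.
move=> fx; rewrite ler_pdivlMr//.
have -> : 2 / r * `|h| = a^-1 by rewrite /a invfM invrK mulrAC mulrC mulrA.
have : - (1 - t) <= t * (f (x + s *: h) - f x).
  have : (1 - t) * f (x - a *: h) <= (1 - t) * (f x + 1).
    by rewrite ler_wpM2l// subr_ge0.
  by lra.
rewrite tE /t mulrAC -mulNr ler_pM2r ?invr_gt0// => h1.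
rewrite mulNr mulrC -mulNr ler_pdivrMr// mulrC; lra.
Qed.

(** The space [E] is embedded in [V] by [hat], and the subgradient is obtained
as a functional on all of [V]. The sublinear functional to which the
Hahn-Banach theorem is applied is the infimal convolution of the directional
derivative of [f] at [x] with a multiple of the norm of [V]: the infimum runs
over the directions [h] and over the steps [s] of the difference quotients. *)
Lemma subgradient (U : set E) f x (r : R) : convex_on U f -> 0 < r ->
    (forall y, `|y - x| < r -> U y /\ f y <= f x + 1) ->
  exists (phi : V -> R) (M : R),
    [/\ 0 <= M, forall u v, phi (u + v) = phi u + phi v,
        forall t v, phi (t *: v) = t * phi v,
        forall v, `|phi v| <= M * `|v|
      & forall y, U y -> f x + phi (hat (y - x)) <= f y].
Proof.
move=> cf r0 fr.
have Ux : U x by have [] := fr x; rewrite ?subrr ?normr0.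
pose M := 2 * (2 / r); have M0 : 0 <= M by rewrite !mulr_ge0 ?invr_ge0// ltW.
pose G (sh : R * E) v := (f (x + sh.1 *: sh.2) - f x) / sh.1 + M * `|v - hat sh.2|.
pose D := [set sh : R * E | 0 < sh.1 /\ U (x + sh.1 *: sh.2)].
pose A v := [set G sh v | sh in D].
have D1 : D (1, 0) by split=> //=; rewrite scaler0 addr0.
have A0 v : A v !=set0 by exists (G (1, 0) v); exists (1, 0).
have hat0 : hat 0 = 0 by have := hatZ 0 0; rewrite scaler0 scale0r.
have Alb v : has_lbound (A v).
  exists (- (M * `|v|)) => _ [[s h] [/= s0 Uh] <-]; rewrite /G /=.
  have := convex_quotient_ge cf r0 fr s0 Uh.
  have : 2 / r * `|h| <= 2 / r * (2 * `|hat h|).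
    by rewrite ler_wpM2l// mulr_ge0 ?invr_ge0// ltW.
  have : M * `|hat h| <= M * (`|v| + `|v - hat h|).
    rewrite ler_wpM2l// distrC addrC; apply: le_trans (ler_normD _ _).
    by rewrite subrK.
  by rewrite /M; lra.
have infle v sh : D sh -> inf (A v) <= G sh v by move=> Dsh; apply: ge_inf => //; exists sh.
have sinf : sublinear (fun v => inf (A v)).
  split=> [u v|t v t0]; last first.
    rewrite -ler_pdivrMl//; apply: lb_le_inf => // _ [[s h] [/= s0 Uh] <-].
    rewrite ler_pdivrMl//; apply: le_trans (infle _ (s / t, t *: h) _) _.
      split=> /=; first by rewrite divr_gt0.
      by rewrite scalerA mulfVK// gt_eqF.
    rewrite /G /= scalerA mulfVK ?gt_eqF// hatZ -scalerBr normrZ gtr0_norm//.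
    by rewrite le_eqVlt; apply/orP; left; apply/eqP; field; rewrite !gt_eqF.
  apply: le_infD => // _ _ [[s h] [/= s0 Uh] <-] [[s' h'] [/= s'0 Uh'] <-].
  have ss' : 0 < s + s' by rewrite addr_gt0.
  (* The convex combination with weights proportional to [s'] and [s] moves from
     [x] by [w *: (h + h')], [w] being half the harmonic mean of the steps. *)
  pose t := s' / (s + s').
  have t0 : 0 <= t by rewrite divr_ge0// ltW.
  have tE : 1 - t = s / (s + s').
    by rewrite -[1](@divff _ (s + s')) ?gt_eqF// -mulrBl addrK.
  have t1 : t <= 1 by rewrite -subr_ge0 tE divr_ge0// ltW.
  have [Uc fc] := cf _ _ t Uh Uh' t0 t1.
  pose w := s * s' / (s + s').
  have w0 : 0 < w by rewrite divr_gt0// mulr_gt0.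
  have cE : t *: (x + s *: h) + (1 - t) *: (x + s' *: h') = x + w *: (h + h').
    rewrite !scalerDr addrACA -scalerDl [t + _]addrC subrK scale1r !scalerA.
    by congr (_ + (_ *: _ + _ *: _)); rewrite ?tE /t /w; field; rewrite gt_eqF.
  rewrite cE in Uc fc.
  apply: le_trans (infle _ (w, h + h') _) _ => //.
  rewrite /G /= hatD opprD [u + v + _]addrACA.
  have : M * `|u - hat h + (v - hat h')| <= M * `|u - hat h| + M * `|v - hat h'|.
    by rewrite -mulrDr ler_wpM2l// ler_normD.
  suff : (f (x + w *: (h + h')) - f x) / w <=
    (f (x + s *: h) - f x) / s + (f (x + s' *: h') - f x) / s' by lra.
  rewrite ler_pdivrMr//; apply: le_trans (_ : t * (f (x + s *: h) - f x) +
    (1 - t) * (f (x + s' *: h') - f x) <= _); first by move: fc; lra.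
  rewrite tE /t /w le_eqVlt; apply/orP; left; apply/eqP.
  by field; rewrite !gt_eqF.
have [phi [phiD phiZ phi_le]] := hahn_banach sinf.
have phiN v : phi (- v) = - phi v by rewrite -scaleN1r phiZ mulN1r.
have phi_leM v : phi v <= M * `|v|.
  apply: le_trans (phi_le v) (le_trans (infle v _ D1) _).
  by rewrite /G /= scaler0 addr0 subrr mul0r add0r hat0 subr0.
exists phi, M; split=> // [v|y Uy].
  by rewrite ler_norml phi_leM andbT lerNl -phiN (le_trans (phi_leM _))// normrN.
rewrite -lerBrDl; apply: le_trans (phi_le _) _.
apply: le_trans (infle _ (1, y - x) _) _; first by split=> //=; rewrite scale1r subrKC.
by rewrite /G /= scale1r subrKC subrr normr0 mulr0 addr0 divr1.
Qed.

End Subgradient.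

(** * Functionals on a space with countably many points *)

Section CountableSpace.
Context {R : realType} {S : Type}.

(** The real case of [linf], with norms in [R] rather than in the scalar field
of [real_scalars R]. *)
Definition rlinf : completeNormedModType R :=
  (linf (real_scalars R) S : completeNormedModType (sK (real_scalars R))).

Definition rval (v : rlinf) : S -> R := linf_fun v.

Lemma rvalD (u v : rlinf) s : rval (u + v) s = rval u s + rval v s.
Proof. by []. Qed.

Lemma rvalB (u v : rlinf) s : rval (u - v) s = rval u s - rval v s.
Proof. by []. Qed.

Lemma rvalZ t (v : rlinf) s : rval (t *: v) s = t * rval v s.
Proof. by []. Qed.

Lemma le_rval (v : rlinf) s : `|rval v s| <= `|v|.
Proof. exact: (@le_linf _ (real_scalars R)). Qed.

Lemma rval_le (v : rlinf) M : 0 <= M -> (forall s, `|rval v s| <= M) -> `|v| <= M.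
Proof. exact: (@linf_le _ (real_scalars R)). Qed.

Lemma rval_inj (u v : rlinf) : rval u =1 rval v -> u = v.
Proof. by move=> uv; apply: val_inj; apply/funext. Qed.

Lemma mk_rlinf (f : S -> R) M : (forall s, `|f s| <= M) ->
  {v : rlinf | rval v = f}.
Proof.
move=> fM; have fb : @bounded_pred R (real_scalars R) S f by apply/asboolP; exists M.
by exists (@Linf R (real_scalars R) S f fb).
Qed.

Lemma restr_bound (W : set S) (v : rlinf) s : `|if `[< W s >] then rval v s else 0| <= `|v|.
Proof. by case: asboolP => _; rewrite ?le_rval// normr0. Qed.

Definition restr (W : set S) (v : rlinf) : rlinf := sval (mk_rlinf (restr_bound W v)).

Lemma restrE W v s : rval (restr W v) s = if `[< W s >] then rval v s else 0.
Proof. by rewrite /restr (svalP (mk_rlinf _)). Qed.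

Lemma restr_le W v : `|restr W v| <= `|v|.
Proof. by apply: rval_le => // s; rewrite restrE restr_bound. Qed.

Definition rcst (t : R) : rlinf := sval (@mk_rlinf (fun=> t) `|t| (fun=> lexx _)).

Lemma rcstE t s : rval (rcst t) s = t.
Proof. by rewrite /rcst (svalP (mk_rlinf _)). Qed.

(** [N i] is a base of neighbourhoods of the point [e i] for a compact topology
in which every point is indistinguishable from some [e i]; compactness is
recorded for covers by one neighbourhood of each [e i]. *)
Record countable_compact (e : nat -> S) (N : nat -> set (set S)) : Prop := {
  ccT : forall i, N i !=set0;
  ccI : forall i A B, N i A -> N i B -> N i (A `&` B);
  ccK : forall U : nat -> set S, (forall i, N i (U i)) ->
          exists m, forall s, exists2 i, (i < m)%N & U i s }.

Variables (e : nat -> S) (N : nat -> set (set S)).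

Definition continuous_along (v : rlinf) := forall i t, 0 < t ->
  exists2 A, N i A & forall s, A s -> `|rval v s - rval v (e i)| <= t.

(** The coefficients are rational in order that there be countably many such
functionals, as the Baire category theorem demands. *)
Definition atomic (c : seq rat) (v : rlinf) : R :=
  \sum_(i < size c) ratr c`_i * rval v (e i).

Section Atomic.
Variables (phi : rlinf -> R) (M : R).
Hypothesis M0 : 0 <= M.
Hypothesis phiD : forall u v, phi (u + v) = phi u + phi v.
Hypothesis phiZ : forall t v, phi (t *: v) = t * phi v.
Hypothesis phiM : forall v, `|phi v| <= M * `|v|.

Let phiN v : phi (- v) = - phi v.
Proof. by rewrite -scaleN1r phiZ mulN1r. Qed.

Let phi0 : phi 0 = 0.
Proof. by rewrite -(scaler0 _ 0) phiZ mul0r. Qed.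

(** The total variation of the finitely additive measure that [phi] is on the
algebra of all subsets. *)
Definition variation (W : set S) : R :=
  sup [set phi v | v in [set v : rlinf | `|v| <= 1 /\ forall s, ~ W s -> rval v s = 0]].


Let supported (W : set S) := [set v : rlinf | `|v| <= 1 /\ forall s, ~ W s -> rval v s = 0].

Let variation_has_sup W : has_sup [set phi v | v in supported W].
Proof.
split; first by exists (phi 0), 0 => //; split=> //; rewrite normr0.
exists M => _ [v [v1 _] <-]; apply: le_trans (ler_norm _) _.
by apply: le_trans (phiM v) _; rewrite -[leRHS]mulr1 ler_wpM2l.
Qed.

Let le_variation W v : supported W v -> phi v <= variation W.
Proof. by move=> Wv; apply: ub_le_sup; [case: (variation_has_sup W)|exists v]. Qed.

Let variation_ge0 W : 0 <= variation W.
Proof. by rewrite -phi0 le_variation//; split=> //; rewrite normr0. Qed.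

(** Two functions of norm at most one with disjoint supports have a sum of norm
at most one. *)
Let variation_superadditive A B : A `<=` B ->
  variation A + variation (B `\` A) <= variation B.
Proof.
move=> AB; rewrite -lerBrDr; apply: ge_sup; first by case: (variation_has_sup A).
move=> _ [u [u1 uA] <-]; rewrite lerBrDr -lerBrDl.
apply: ge_sup; first by case: (variation_has_sup (B `\` A)).
move=> _ [v [v1 vB] <-]; rewrite lerBrDl -phiD; apply: le_variation; split.
  apply: rval_le => // s; rewrite rvalD; have [As|nAs] := pselect (A s).
    by rewrite vB ?addr0; [apply: le_trans (le_rval u s) u1|case].
  by rewrite uA// add0r; apply: le_trans (le_rval v s) v1.
move=> s nBs; rewrite rvalD uA ?vB ?addr0//; first by case.
by move=> /AB.
Qed.

Let phi_variation W v : (forall s, ~ W s -> rval v s = 0) ->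
  `|phi v| <= variation W * `|v|.
Proof.
move=> vW; have [->|v0] := eqVneq v 0; first by rewrite phi0 !normr0 mulr0.
have nv : 0 < `|v| by rewrite normr_gt0.
suff h u : (forall s, ~ W s -> rval u s = 0) -> `|u| = `|v| -> phi u <= variation W * `|v|.
  rewrite ler_norml h// andbT lerNl -phiN h ?normrN// => s /vW.
  by rewrite -scaleN1r rvalZ => ->; rewrite mulr0.
move=> uW uv; rewrite -ler_pdivrMr// mulrC -phiZ; apply: le_variation.
split; first by rewrite normrZ uv ger0_norm ?invr_ge0// mulVf ?gt_eqF.
by move=> s /uW; rewrite rvalZ => ->; rewrite mulr0.
Qed.

(** Take a neighbourhood of nearly minimal variation: by superadditivity almost
no variation is left outside any smaller one. *)
Let small_nbhd (cc : countable_compact e N) i (t : R) : 0 < t ->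
  exists2 U, N i U & forall A, N i A -> variation (U `\` A) <= t.
Proof.
move=> t0; pose D := [set variation U | U in N i].
have hD : has_inf D.
  split; last by exists 0 => _ [U _ <-]; exact: variation_ge0.
  by have [U NU] := ccT cc i; exists (variation U), U.
have [_ [U NU <-] Ut] := inf_adherent t0 hD; exists U => // A NA.
have := @variation_superadditive (U `&` A) U (@subIsetl _ _ _).
have : inf D <= variation (U `&` A).
  by apply: ge_inf; [case: hD|exists (U `&` A) => //; apply: (ccI cc)].
by rewrite setDIr setDv set0U; move: Ut; lra.
Qed.

(** On a set [W] contained in such a neighbourhood, [phi] is nearly a multiple
of the evaluation at [e i], whether or not [e i] belongs to [W]. *)
Let local_atom i (t : R) (U W : set S) v : 0 <= t ->
    (forall A, N i A -> variation (U `\` A) <= t) -> W `<=` U ->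
    continuous_along v ->
  `|phi (restr W v) - phi (restr W (rcst 1)) * rval v (e i)| <= 2 * t * `|v|.
Proof.
move=> t0 Ut WU vc; set a := rval v (e i).
have -> : phi (restr W v) - phi (restr W (rcst 1)) * a = phi (restr W (v - rcst a)).
  rewrite mulrC -phiZ -phiN -phiD; congr (phi _); apply: rval_inj => s.
  rewrite rvalD -scaleN1r !rvalZ !restrE rvalB !rcstE.
  by case: asboolP => _; ring.
have h x : 0 < x ->
    `|phi (restr W (v - rcst a))| <= 2 * t * `|v| + M * x.
  move=> x0; have [A NA Ax] := vc i x x0.
  have -> : restr W (v - rcst a) =
      restr (W `\` A) (v - rcst a) + restr (W `&` A) (v - rcst a).
    apply: rval_inj => s; rewrite rvalD !restrE.
    by do 3![case: asboolP]; rewrite ?addr0 ?add0r// /setI /setD /=; tauto.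
  rewrite phiD; apply: le_trans (ler_normD _ _) _; apply: lerD.
    apply: le_trans (@phi_variation (U `\` A) _ _) _.
      move=> s nUA; rewrite restrE; case: asboolP => // -[Ws nAs].
      by case: nUA; split=> //; apply: WU.
    rewrite [2 * t]mulrC -mulrA; apply: ler_pM => //; first exact: Ut.
    apply: le_trans (restr_le _ _) _; apply: le_trans (ler_normB _ _) _.
    suff : `|rcst a| <= `|v| by lra.
    by apply: rval_le => // s; rewrite rcstE le_rval.
  apply: le_trans (phiM _) _; rewrite ler_wpM2l//; apply: rval_le; first exact: ltW.
  move=> s; rewrite restrE; case: asboolP => [[_ /Ax]|_]; first by rewrite rvalB rcstE.
  by rewrite normr0 ltW.
apply/ler_addgt0Pr => x x0.
have M1 : 0 < M + 1 by rewrite ltr_wpDl.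
apply: le_trans (h (x / (M + 1)) (divr_gt0 x0 M1)) _.
by rewrite lerD2l mulrA ler_pdivrMr// mulrDr mulr1 [M * _]mulrC lerDl ltW.
Qed.

(** Bounded functionals are approximated in norm by finite rational
combinations of evaluations, as far as continuous functions are concerned: cut
the space into finitely many pieces, each inside a neighbourhood of some [e i]
on which [phi] almost has no variation apart from an atom. *)
Lemma atomic_approximation (cc : countable_compact e N) (eps : R) : 0 < eps ->
  exists c : seq rat, forall v, continuous_along v ->
    `|phi v - atomic c v| <= eps * `|v|.
Proof.
(* The piece [k] causes an error [4 * t k = eps / 2 ^+ k.+1]: [2 * t k] from
   [local_atom] and [2 * t k] from the choice of a rational coefficient. *)
move=> eps0; pose t i : R := eps / 2 ^+ (i + 3).
have t0 i : 0 < t i by rewrite divr_gt0// exprn_gt0.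
have /choice[U UP] i : exists U, N i U /\ forall A, N i A -> variation (U `\` A) <= t i.
  by have [U NU UA] := small_nbhd cc i (t0 i); exists U.
have [m mP] := ccK cc (fun i => (UP i).1).
pose D k := [set s | exists2 i, (i < k)%N & U i s].
pose W k := U k `\` D k.
have /choice[q qP] k : exists q : rat, `|phi (restr (W k) (rcst 1)) - ratr q| <= 2 * t k.
  set x := phi _; have [|q] := @rat_in_itvoo R (x - t k) (x + t k).
    by have := t0 k; lra.
  rewrite in_itv /= => /andP[q1 q2]; exists q.
  by rewrite ler_norml; have := t0 k; lra.
exists (mkseq q m) => v vc.
suff h k : `|phi (restr (D k) v) - \sum_(i < k) ratr (q i) * rval v (e i)| <=
    eps * (1 - 2^-1 ^+ k) * `|v|.
  have := h m; have -> : restr (D m) v = v.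
    by apply: rval_inj => s; rewrite restrE asboolT//; apply: mP.
  rewrite /atomic size_mkseq; have -> : \sum_(i < m) ratr (mkseq q m)`_i * rval v (e i) =
      \sum_(i < m) ratr (q i) * rval v (e i).
    by apply: eq_bigr => i _; rewrite nth_mkseq.
  move/le_trans; apply; rewrite ler_wpM2r// ler_piMr ?(ltW eps0)//.
elim: k => [|k IH].
  rewrite big_ord0 subr0 expr0 subrr mulr0 mul0r.
  have -> : restr (D 0) v = 0; last by rewrite phi0 normr0.
  by apply: rval_inj => s; rewrite restrE asboolF//; case.
have -> : restr (D k.+1) v = restr (D k) v + restr (W k) v.
  apply: rval_inj => s; rewrite rvalD !restrE.
  have -> : D k.+1 s = (D k s \/ W k s).
    apply/propext; split=> [[j ] | [[j jk Uj] | [Uk _]]].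
    - rewrite ltnS leq_eqVlt => /orP[/eqP->|jk] Uj; last by left; exists j.
      by have [|nD] := pselect (D k s); [left|right].
    - by exists j => //; apply: leq_trans jk _.
    - by exists k.
  have nDW : D k s -> ~ W k s by move=> Ds [].
  by do 3![case: asboolP]; rewrite ?addr0 ?add0r//; tauto.
rewrite phiD big_ord_recr /=.
set A := phi (restr (D k) v) in IH *; set B := phi (restr (W k) v).
set T := \sum_(i < k) _ in IH *; set r := ratr (q k) : R; set a := rval v (e k).
have h1 : `|B - phi (restr (W k) (rcst 1)) * a| <= 2 * t k * `|v|.
  by apply: local_atom (ltW (t0 k)) (UP k).2 _ vc => s [].
have h2 : `|phi (restr (W k) (rcst 1)) * a - r * a| <= 2 * t k * `|v|.
  by rewrite -mulrBl normrM ler_pM// le_rval.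
have -> : A + B - (T + r * a) = (A - T) +
    ((B - phi (restr (W k) (rcst 1)) * a) + (phi (restr (W k) (rcst 1)) * a - r * a)).
  by ring.
apply: le_trans (ler_normD _ _) _.
have -> : eps * (1 - 2^-1 ^+ k.+1) * `|v| =
    eps * (1 - 2^-1 ^+ k) * `|v| + (2 * t k * `|v| + 2 * t k * `|v|).
  by rewrite /t exprD exprS exprVn; field; rewrite expf_neq0.
by apply: lerD => //; apply: le_trans (ler_normD _ _) _; apply: lerD.
Qed.

End Atomic.
End CountableSpace.

(** * Points of small second difference *)

Section SmallSecondDifference.
Context {R : realType} {S : Type}.

(** Second differences do not mention the approximating affine function, so
that this property passes to subspaces and its failure is witnessed by two
points. *)
Definition flat_on_ball (E : normedModType R) (U : set E) (f : E -> R)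
    (eps : R) (x : E) (r : R) :=
  [/\ 0 < r, forall y, `|x - y| < r -> U y
    & forall y h, `|x - y| < r -> `|x - (y + h)| < r -> `|x - (y - h)| < r ->
        f (y + h) + f (y - h) - 2 * f y <= eps * `|h|].

Lemma locally_bounded (E : normedModType R) (U : set E) (f : E -> R) x :
    open U -> U x -> {for x, continuous f} ->
  exists2 r, 0 < r & forall y, `|y - x| < r -> U y /\ f y <= f x + 1.
Proof.
move=> oU Ux fx.
have : \forall y \near x, U y /\ f y <= f x + 1.
  near=> y; split; first by near: y; exact: open_nbhs_nbhs.
  suff : `|f x - f y| <= 1 by rewrite ler_norml; lra.
  by near: y; move/cvgrPdist_le : fx; apply.
move=> /nbhs_normP[r /= r0 h]; exists r => // y yx; apply: h.
by rewrite /= distrC.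
Unshelve. all: by end_near. Qed.

Section OneBall.
Context {E : completeNormedModType R}.
Variable hat : E -> @rlinf R S.
Hypothesis hatD : forall x y, hat (x + y) = hat x + hat y.
Hypothesis hatZ : forall t x, hat (t *: x) = t *: hat x.
Hypothesis hat_le : forall x, `|hat x| <= `|x|.
Hypothesis hat_ge : forall x, `|x| <= 2 * `|hat x|.
Variables (e : nat -> S) (N : nat -> set (set S)).
Hypothesis cc : countable_compact e N.
Hypothesis hat_continuous : forall x, continuous_along e N (hat x).

Let psi (c : seq rat) (x : E) : R := atomic e c (hat x).

Let psiD c x y : psi c (x + y) = psi c x + psi c y.
Proof.
by rewrite /psi /atomic -big_split; apply: eq_bigr => i _; rewrite hatD rvalD mulrDr.
Qed.

Let psiN c x : psi c (- x) = - psi c x.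
Proof.
rewrite /psi /atomic -sumrN; apply: eq_bigr => i _.
by rewrite -scaleN1r hatZ rvalZ mulN1r mulrN.
Qed.

Let psi_bounded c : exists2 B, 0 <= B & forall x, `|psi c x| <= B * `|x|.
Proof.
exists (\sum_(i < size c) `|ratr c`_i|); first exact: sumr_ge0.
move=> x; rewrite /psi /atomic mulr_suml; apply: le_trans (ler_norm_sum _ _ _) _.
apply: ler_sum => i _; rewrite normrM ler_wpM2l//.
exact: le_trans (le_rval _ _) (hat_le x).
Qed.

(** Every point of [U] has an approximate subgradient in the countable family
[psi]; by the Baire category theorem one member of the family serves on a
whole ball. *)
Lemma small_second_difference (U : set E) f (eps : R) :
    open U -> U !=set0 -> convex_on U f ->
    (forall x, U x -> {for x, continuous f}) -> 0 < eps ->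
  exists x r, flat_on_ball U f eps x r.
Proof.
move=> oU [u0 Uu0] cf fc eps0.
pose d := eps / 2; have d0 : 0 < d by rewrite divr_gt0.
pose A c := [set x | U x /\ forall y, U y -> f x + psi c (y - x) - d * `|y - x| <= f y].
have Acov x : U x -> exists c, A c x.
  move=> Ux; have [r r0 fr] := locally_bounded oU Ux (fc x Ux).
  have [phi [M [M0 phiD phiZ phiM phif]]] := subgradient hatD hatZ hat_ge cf r0 fr.
  have [c cP] := atomic_approximation M0 phiD phiZ phiM cc d0.
  exists c; split=> // y Uy; apply: le_trans (phif y Uy).
  have := cP _ (hat_continuous (y - x)); rewrite ler_norml => /andP[h _].
  have : d * `|hat (y - x)| <= d * `|y - x| by rewrite ler_wpM2l// ltW.
  by move: h; rewrite -/(psi c _); lra.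
have Aclosed c x : U x -> closure (A c) x -> A c x.
  move=> Ux clx; split=> // y Uy.
  have [B B0 psiB] := psi_bounded c.
  apply/ler_addgt0Pr => t t0.
  (* Replacing [x] by a point at distance [s] where [f] differs by at most [s]
     costs [s] for [f], [B * s] for [psi c] and [d * s] for the norm. *)
  pose s := t / (1 + B + d); have Bd0 : 0 < 1 + B + d by lra.
  have s0 : 0 < s by rewrite divr_gt0.
  have [x' [[Ux' Ax'] [fx' xx']]] : (A c `&` [set x' | `|f x - f x'| <= s /\ `|x - x'| < s]) !=set0.
    apply: clx; near=> x'; split.
      by near: x'; move/cvgrPdist_le : (fc x Ux); apply.
    by near: x'; apply/nbhs_normP; exists s.
  have := Ax' y Uy.
  have -> : y - x' = (y - x) + (x - x') by rewrite addrA subrK.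
  rewrite psiD; have := psiB (x - x').
  have : B * `|x - x'| <= B * s by rewrite ler_wpM2l// ltW.
  have : d * `|y - x + (x - x')| <= d * `|y - x| + d * s.
    by rewrite -mulrDr ler_wpM2l ?(ltW d0)//; apply: le_trans (ler_normD _ _) _; rewrite lerD2l ltW.
  have : t = s + B * s + d * s by rewrite /s; field; rewrite gt_eqF.
  move: fx'; rewrite !ler_norml => /andP[_ h1] -> h2 h3 /andP[h4 _].
  by lra.
pose cs n : seq rat := odflt [::] (unpickle n).
have [n nd] : exists n, ~ dense (~` closure (A (cs n))).
  apply: contrapT => /forallNP h.
  have /(_ U (ex_intro _ u0 Uu0) oU)[x [Ux xA]] :
      dense (\bigcap_n (~` closure (A (cs n)))).
    apply: Baire => n; split; first exact/closed_openC/closed_closure.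
    by apply: contrapT; apply: h.
  have [c Acx] := Acov x Ux; have := xA (pickle c) Logic.I; apply.
  by rewrite /cs pickleK /=; apply: subset_closure.
have [W [[x0 Wx0] oW WA]] : exists W : set E, [/\ W !=set0, open W & W `<=` closure (A (cs n))].
  move: nd; rewrite /dense => /existsNP[W /not_implyP[W0 /not_implyP[oW /set0P/negP]]].
  rewrite negbK => /eqP WA; exists W; split=> // x Wx; apply: contrapT => nAx.
  by have : (W `&` ~` closure (A (cs n))) x by []; rewrite WA.
have [x1 [[Ux1 _] Wx1]] := WA x0 Wx0 W (open_nbhs_nbhs (conj oW Wx0)).
have : nbhs x1 (W `&` U) by apply: open_nbhs_nbhs; split=> //; apply: openI.
move=> /nbhs_normP[r /= r0 WUr]; exists x1, r.
have Ur y : `|x1 - y| < r -> U y by move=> /WUr[].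
have Ar y : `|x1 - y| < r -> A (cs n) y.
  by move=> xy; apply: Aclosed; [exact: Ur|apply: WA; have [] := WUr y xy].
split=> // y h xy xyh xyNh.
(* Add the approximate subgradient inequalities at [y + h] and at [y - h]. *)
have [_ /(_ y (Ur y xy))] := Ar _ xyh.
have [_ /(_ y (Ur y xy))] := Ar _ xyNh.
rewrite opprB addrCA subrr addr0 opprD addNKr psiN normrN /d; lra.
Unshelve. all: by end_near. Qed.

End OneBall.
End SmallSecondDifference.

(** * Separable reduction and generic differentiability *)

Lemma rat_approx (R : realType) (a t : R) : 0 < t ->
  exists q : rat, `|a - ratr q| <= t.
Proof.
move=> t0; have [|q] := @rat_in_itvoo R (a - t) (a + t); first lra.
by rewrite in_itv /= => /andP[q1 q2]; exists q; rewrite ler_norml; lra.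
Qed.

Section GenericDifferentiability.
Context {R : realType} {S : Type} {E : completeNormedModType R}.
Variable hat : E -> @rlinf R S.
Hypothesis hatD : forall x y, hat (x + y) = hat x + hat y.
Hypothesis hatZ : forall t x, hat (t *: x) = t *: hat x.
Hypothesis hat_le : forall x, `|hat x| <= `|x|.
Hypothesis hat_ge : forall x, `|x| <= 2 * `|hat x|.
Hypothesis separably_countable : forall u : nat -> E,
  exists (e : nat -> S) (N : nat -> set (set S)),
    countable_compact e N /\ forall n, continuous_along e N (hat (u n)).

Section RationalSpan.
Variables (x0 : E) (w : E -> nat -> E * E).

(** Trees labelled with rational numbers form a countable type, so the values
of this interpretation are a countable set; its clauses make that set closed
under addition, rational scaling and both components of [w]. *)
Fixpoint tree_eval (t : GenTree.tree rat) : E :=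
  match t with
  | GenTree.Leaf _ => x0
  | GenTree.Node 0 [:: a; b] => tree_eval a + tree_eval b
  | GenTree.Node 1 [:: GenTree.Leaf q; a] => ratr q *: tree_eval a
  | GenTree.Node k.+2 [:: a] => (w (tree_eval a) k).1
  | GenTree.Node k.+2 [:: a; _] => (w (tree_eval a) k).2
  | _ => x0
  end.

Let D := range tree_eval.

Lemma span_x0 : D x0. Proof. by exists (GenTree.Leaf 0). Qed.

Lemma span_D x y : D x -> D y -> D (x + y).
Proof. by move=> [s _ <-] [t _ <-]; exists (GenTree.Node 0 [:: s; t]). Qed.

Lemma span_Z q x : D x -> D (ratr q *: x).
Proof. by move=> [s _ <-]; exists (GenTree.Node 1 [:: GenTree.Leaf q; s]). Qed.

Lemma span_w1 k x : D x -> D (w x k).1.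
Proof. by move=> [s _ <-]; exists (GenTree.Node k.+2 [:: s]). Qed.

Lemma span_w2 k x : D x -> D (w x k).2.
Proof. by move=> [s _ <-]; exists (GenTree.Node k.+2 [:: s; s]). Qed.

Let Y : set E := [set x | forall t : R, 0 < t -> exists2 d, D d & `|x - d| < t].

Let sub_Y d : D d -> Y d.
Proof. by move=> Dd t t0; exists d => //; rewrite subrr normr0. Qed.

Let Y_closed : closed Y.
Proof.
move=> x clx t t0; have t2 : 0 < t / 2 by rewrite divr_gt0.
have [y [Yy /= xy]] : (Y `&` [set y | `|x - y| < t / 2]) !=set0.
  by apply: clx; apply/nbhs_normP; exists (t / 2).
have [d Dd yd] := Yy _ t2; exists d => //.
by rewrite (le_lt_trans (ler_distD y _ _))// [t]splitr ltrD.
Qed.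

Let Y_D x y : Y x -> Y y -> Y (x + y).
Proof.
move=> Yx Yy t t0; have t2 : 0 < t / 2 by rewrite divr_gt0.
have [a Da xa] := Yx _ t2; have [b Db yb] := Yy _ t2.
exists (a + b); first exact: span_D.
by rewrite opprD addrACA (le_lt_trans (ler_normD _ _))// [t]splitr ltrD.
Qed.

Let Y_Z a x : Y x -> Y (a *: x).
Proof.
move=> Yx t t0; have x1 : 0 < `|x| + 1 by rewrite ltr_wpDl.
have t2 : 0 < t / 2 by rewrite divr_gt0.
have [q aq] := @rat_approx R a (t / 2 / (`|x| + 1)) (divr_gt0 t2 x1).
have q1 : 0 < `|ratr q : R| + 1 by rewrite ltr_wpDl.
have [d Dd xd] := Yx _ (divr_gt0 t2 q1).
exists (ratr q *: d); first exact: span_Z.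
have -> : a *: x - ratr q *: d = (a - ratr q) *: x + ratr q *: (x - d).
  by rewrite scalerBl scalerBr addrA subrK.
apply: le_lt_trans (ler_normD _ _) _; rewrite !(@normrZ _ E) [t]splitr.
apply: ler_ltD.
  rewrite -(ler_pM2r x1) -mulrA [`|x| * _]mulrC mulrA.
  apply: le_trans (_ : t / 2 * `|x| <= _); last by rewrite ler_wpM2l ?(ltW t2)// lerDl.
  by rewrite ler_wpM2r// -ler_pdivlMr.
apply: le_lt_trans (_ : (`|ratr q| + 1) * `|x - d| < _).
  by rewrite ler_wpM2r// lerDl.
by rewrite mulrC -ltr_pdivlMr.
Qed.

Let Y_0 : Y 0.
Proof. by apply: sub_Y; rewrite -(scale0r x0) -(rmorph0 ratr); apply: span_Z span_x0. Qed.

Definition span_closure : closed_subspace E := ClosedSubspace Y_closed Y_0 Y_D Y_Z.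

Lemma span_sub d : D d -> cs_set span_closure d.
Proof. exact: sub_Y. Qed.

Lemma span_dense x t : cs_set span_closure x -> 0 < t -> exists2 d, D d & `|x - d| < t.
Proof. by move=> Yx t0; apply: Yx. Qed.

(** Continuity along the neighbourhoods passes to uniform limits. *)
Lemma span_continuous : exists (e : nat -> S) (N : nat -> set (set S)),
  countable_compact e N /\
  forall x, cs_set span_closure x -> continuous_along e N (hat x).
Proof.
pose u n := tree_eval (odflt (GenTree.Leaf 0) (unpickle n)).
have [e [N [cc uc]]] := separably_countable u; exists e, N; split=> // x Yx i t t0.
have t3 : 0 < t / 3 by rewrite divr_gt0.
have [d [c _ cd] xd] := span_dense Yx t3.
have dc : continuous_along e N (hat d) by have := uc (pickle c); rewrite /u pickleK /= cd.
have [A NA Ad] := dc i _ t3; exists A => // s As.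
have near_d s' : `|rval (hat x) s' - rval (hat d) s'| <= t / 3.
  have hatB : hat x - hat d = hat (x - d).
    by rewrite -scaleN1r -hatZ -hatD scaleN1r.
  rewrite -rvalB hatB; apply: le_trans (le_rval _ _) _.
  exact: le_trans (hat_le _) (ltW xd).
move: (near_d s) (near_d (e i)) (Ad s As); rewrite !ler_norml.
by move=> /andP[? ?] /andP[? ?] /andP[? ?]; lra.
Qed.

End RationalSpan.

(** If no ball were flat, closing a point under rational combinations and
witnesses of the failure would give a separable subspace where no ball is flat
either, against [small_second_difference]. *)
Lemma flat_ball_exists (U : set E) f (eps : R) :
    open U -> U !=set0 -> convex_on U f ->
    (forall x, U x -> {for x, continuous f}) -> 0 < eps ->
  exists x r, flat_on_ball U f eps x r.
Proof.
move=> oU [x0 Ux0] cf fc eps0; apply: contrapT => nflat.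
pose rad k : R := k.+1%:R^-1.
have rad0 k : 0 < rad k by rewrite invr_gt0.
have /choice[w wP] (xk : E * nat) : exists yh : E * E,
    (forall y, `|xk.1 - y| < rad xk.2 -> U y) ->
    [/\ `|xk.1 - yh.1| < rad xk.2, `|xk.1 - (yh.1 + yh.2)| < rad xk.2,
        `|xk.1 - (yh.1 - yh.2)| < rad xk.2
      & eps * `|yh.2| < f (yh.1 + yh.2) + f (yh.1 - yh.2) - 2 * f yh.1].
  have [BU|] := pselect (forall y, `|xk.1 - y| < rad xk.2 -> U y); last by exists (0, 0).
  apply: contrapT => nw; apply: nflat; exists xk.1, (rad xk.2).
  split=> // y h xy xyh xyNh; rewrite leNgt; apply/negP => bad.
  by apply: nw; exists (y, h).
pose Y := span_closure x0 (fun x k => w (x, k)).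
have [e [N [cc Yc]]] := span_continuous x0 (fun x k => w (x, k)).
pose Yt := @cs_type _ E Y.
pose hatY (x : Yt) := hat (cs_val x).
have cs_cont (x : Yt) : {for x, continuous (@cs_val _ E Y)}.
  exact: cs_val_continuous.
have [||||||||||x [r [r0 BU fr]]] := @small_second_difference R S Yt hatY _ _ _ _ e N cc _
    (@cs_val _ E Y @^-1` U) (f \o @cs_val _ E Y) eps.
- by move=> x y; apply: hatD.
- by move=> t x; apply: hatZ.
- by move=> x; apply: hat_le.
- by move=> x; apply: hat_ge.
- by move=> x; apply: Yc; apply: cs_valP.
- by apply: open_comp => // x _; apply: cs_cont.
- by exists (cs_in (span_sub (span_x0 x0 (fun x k => w (x, k))))).
- by move=> x y t Ux Uy t0 t1; apply: cf.
- by move=> x Ux; apply: continuous_comp; [exact: cs_cont|exact: fc].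
- exact: eps0.
have r2 : 0 < r / 2 by rewrite divr_gt0.
have [d Dd xd] := span_dense (cs_valP x) r2.
pose inY z (Dz : range (tree_eval x0 (fun x k => w (x, k))) z) : Yt := cs_in (span_sub Dz).
have Ud : U d by apply: (BU (inY d Dd)); rewrite cs_normE /=; lra.
have [k [kr kU]] : exists k, rad k <= r / 2 /\ forall y, `|d - y| < rad k -> U y.
  have /nbhs_normP[q /= q0 qU] : nbhs d U by exact: open_nbhs_nbhs.
  have m0 : 0 < Num.min (r / 2) q by rewrite lt_min r2.
  exists (Num.bound (Num.min (r / 2) q)^-1).
  have le_m : rad (Num.bound (Num.min (r / 2) q)^-1) <= Num.min (r / 2) q.
    rewrite /rad invf_ple ?posrE//; apply: ltW; apply: lt_le_trans (archi_boundP _) _.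
      by rewrite invr_ge0 ltW.
    by rewrite ler_nat.
  move: le_m; rewrite le_min => /andP[h1 h2]; split=> // y yd.
  by apply: qU; apply: lt_le_trans yd h2.
have [/= dy dyh dyNh] := wP (d, k) kU.
have Dy := span_w1 k Dd; have Dh := span_w2 k Dd.
rewrite ltNge => /negP; apply.
have close z : `|d - z| < rad k -> `|cs_val x - z| < r.
  move=> dz; apply: le_lt_trans (ler_distD d _ _) _; rewrite [r]splitr ltrD//.
  exact: lt_le_trans dz kr.
by apply: (fr (inY _ Dy) (inY _ Dh)); rewrite cs_normE; apply: close.
Qed.

(** The points with flat balls of every precision form a dense set of countable
intersection type, and a subgradient at such a point is a derivative. *)
Theorem generic_differentiability (U : set E) f :
    open U -> convex_on U f -> (forall x, U x -> {for x, continuous f}) ->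
  exists D : set E, [/\ D `<=` U, Gdelta D, U `<=` closure D
    & forall x, D x -> exists (L : E -> R) (M : R),
      [/\ 0 <= M, forall u v, L (u + v) = L u + L v,
          forall t u, L (t *: u) = t * L u, forall u, `|L u| <= M * `|u|
        & forall eps, 0 < eps -> exists2 r, 0 < r &
            forall h, `|h| < r -> `|f (x + h) - f x - L h| <= eps * `|h|]].
Proof.
move=> oU cf fc.
pose G n := [set x | exists r, flat_on_ball U f n.+1%:R^-1 x r].
have oG n : open (G n).
  rewrite openE => x [r [r0 BU fr]]; apply/nbhs_normP; exists (r / 2) => /=; first by rewrite divr_gt0.
  move=> y /= xy; exists (r / 2).
  have close z : `|y - z| < r / 2 -> `|x - z| < r.
    by move=> yz; rewrite (le_lt_trans (ler_distD y _ _))// [r]splitr ltrD.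
  split; first by rewrite divr_gt0.
    by move=> z /close; apply: BU.
  by move=> z h /close ? /close ? /close ?; apply: fr.
have GU n : G n `<=` U by move=> x [r [r0 BU _]]; apply: BU; rewrite subrr normr0.
have Gmeets n (W : set E) : open W -> (W `&` U) !=set0 -> (W `&` G n) !=set0.
  move=> oW [x [Wx Ux]].
  have /nbhs_normP[r /= r0 rWU] : nbhs x (W `&` U).
    by apply: open_nbhs_nbhs; split=> //; apply: openI.
  pose B := [set y | `|x - y| < r].
  have oB : open B.
    rewrite openE => y /= xy; apply/nbhs_normP; exists (r - `|x - y|) => /=; first by rewrite subr_gt0.
    by move=> z /= yz; rewrite /B /= (le_lt_trans (ler_distD y _ _))//; move: yz; lra.
  have [|y z t By Bz t0 t1|y By||y [q [q0 Bq fq]]] :=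
    @flat_ball_exists B f n.+1%:R^-1 oB.
  - by exists x; rewrite /B /= subrr normr0.
  - have [_ Uy] := rWU y By; have [_ Uz] := rWU z Bz.
    split; last by have [] := cf y z t Uy Uz t0 t1.
    rewrite /B /=.
    have -> : x - (t *: y + (1 - t) *: z) = t *: (x - y) + (1 - t) *: (x - z).
      by rewrite !scalerBr addrACA -scalerDl -opprD [t + _]addrC subrK scale1r.
    apply: le_lt_trans (ler_normD _ _) _; rewrite !normrZ !ger0_norm ?subr_ge0//.
    have [->|tn0] := eqVneq t 0; first by rewrite mul0r add0r subr0 mul1r.
    have -> : r = t * r + (1 - t) * r by rewrite -mulrDl [t + _]addrC subrK mul1r.
    apply: ltr_leD; first by rewrite ltr_pM2l// lt_neqAle eq_sym tn0.
    by rewrite ler_wpM2l ?subr_ge0// ltW.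
  - by apply: fc; have [] := rWU y By.
  - by rewrite invr_gt0.
  exists y; have By : B y by apply: Bq; rewrite subrr normr0.
  split; first by have [] := rWU y By.
  by exists q; split=> // z /Bq /rWU[].
pose F n := G n `|` ~` closure U.
have dF : dense (\bigcap_n F n).
  apply: Baire => n; split.
    by apply: openU; [exact: oG|exact/closed_openC/closed_closure].
  move=> W W0 oW; have [WU|nWU] := pselect ((W `&` U) !=set0).
    by have [x [Wx Gx]] := Gmeets n W oW WU; exists x; split=> //; left.
  have [x Wx] := W0; exists x; split=> //; right => clUx; apply: nWU.
  have [y [Uy Wy]] := clUx W (open_nbhs_nbhs (conj oW Wx)).
  by exists y.
exists (\bigcap_n G n); split.
- by move=> x /(_ 0%N Logic.I); apply: GU.
- by exists G.
- move=> x Ux W; rewrite nbhsE => -[W' [oW' W'x] W'W].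
  have [|y [[W'y Uy] Fy]] := dF (W' `&` U) _ (openI oW' oU); first by exists x.
  exists y; split; last exact: W'W.
  move=> n _; have [//|nclU] := Fy n Logic.I.
  by case: nclU; apply: subset_closure.
move=> x Gx; have Ux : U x by apply: GU (Gx 0%N Logic.I).
have [r r0 fr] := locally_bounded oU Ux (fc x Ux).
have [//|//|y|L [M [M0 LD LZ LM Lf]]] := @subgradient R E E id _ _ _ U f x r cf r0 fr.
  by rewrite ler_peMl// ler1n.
exists L, M; split=> // eps eps0.
have [n neps] : exists n, n.+1%:R^-1 <= eps :> R.
  exists (Num.bound eps^-1); rewrite invf_ple ?posrE//.
  apply: ltW; apply: lt_le_trans (archi_boundP _) _; first by rewrite invr_ge0 ltW.
  by rewrite ler_nat.
have [q [q0 Bq fq]] := Gx n Logic.I; exists q => // h hq.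
have LN u : L (- u) = - L u by rewrite -scaleN1r LZ mulN1r.
have xh : `|x - (x + h)| < q by rewrite opprD addNKr normrN.
have xNh : `|x - (x - h)| < q by rewrite opprB addrCA subrr addr0.
have := fq x h _ xh xNh; rewrite subrr normr0 => /(_ q0).
have := Lf _ (Bq _ xh); have := Lf _ (Bq _ xNh).
rewrite ![x + _ - x]addrAC subrr !add0r LN.
have : n.+1%:R^-1 * `|h| <= eps * `|h| by rewrite ler_wpM2r.
have : 0 <= eps * `|h| by rewrite mulr_ge0// ltW.
rewrite ler_norml; set a := _ * `|h|; set b := _ * `|h|; clearbody a b; lra.
Qed.

End GenericDifferentiability.

(** * Asplund spaces over real or complex scalars *)

Section AsplundCriterion.
Context {R : realType} {K : scalars R} {X : completeNormedModType K} {S : Type}.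
Local Notation XR := (realify X).
Variable hat : XR -> @rlinf R S.
Hypothesis hatD : forall x y, hat (x + y) = hat x + hat y.
Hypothesis hatZ : forall t x, hat (t *: x) = t *: hat x.
Hypothesis hat_le : forall x, `|hat x| <= `|x|.
Hypothesis hat_ge : forall x, `|x| <= 2 * `|hat x|.
Hypothesis separably_countable : forall u : nat -> XR,
  exists (e : nat -> S) (N : nat -> set (set S)),
    countable_compact e N /\ forall n, continuous_along e N (hat (u n)).

Lemma open_realify (U : set X) : open (U : set XR) <-> open U.
Proof.
by rewrite !openE; split=> oU x Ux; apply/nbhs_realify; apply: oU.
Qed.

(** The real derivative of the real part of [f], composed with the embedding of
the reals in the scalars, is the derivative sought. *)
Lemma asplund_criterion : Asplund X.
Proof.
move=> U f oU cU fr cf cont.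
have fc x : U x -> {for x, continuous f}.
  by move: cont; rewrite continuous_open_subspace// => h Ux; apply: h; rewrite inE.
pose g : XR -> R := fun x => re (f x).
have fg x : U x -> f x = emb K (g x) by move=> Ux; rewrite real_re// fr.
have oUR : open (U : set XR) by apply/open_realify.
have cg : @convex_on _ XR U g.
  move=> x y t Ux Uy t0 t1.
  have e0 : 0 <= emb K t by rewrite ge0_emb.
  have e1 : emb K t <= 1 by rewrite -(rmorph1 (emb K)) emb_le.
  pose l : {i01 K} := Itv01 e0 e1.
  have xU : x \in U by rewrite inE.
  have yU : y \in U by rewrite inE.
  have E : conv l (x : convex_lmodType X) y =
      (t *: x + (1 - t) *: y : XR).
    by rewrite !realify_scaleE rmorphB rmorph1.
  have Uc : U (t *: x + (1 - t) *: y : XR).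
    by have := cU x y l xU yU; rewrite inE E.
  split=> //; have := cf l x y xU yU; rewrite E convRE.
  rewrite !fg// /=; set l' := (X in _ + X * _).
  have -> : l' = emb K (1 - t) by rewrite rmorphB rmorph1.
  by rewrite -!rmorphM -rmorphD emb_le.
have gc x : U x -> {for x, continuous g}.
  move=> Ux; apply/(@cvgrPdist_le _ _ _ (nbhs (x : XR))) => t t0.
  apply/nbhs_realify.
  have /cvg_rnorm/(_ t t0) : f @ x --> f x := fc x Ux.
  by apply: filterS => y; apply: le_trans; rewrite /g -reB le_re.
have [D [DU [G oG DE] UD Dd]] :=
  @generic_differentiability R S XR hat hatD hatZ hat_le hat_ge separably_countable U g oUR cg gc.
exists D; split=> //.
- by exists G => // n; apply/open_realify.
- by move=> x Ux W Wx; exact: (UD x Ux W ((nbhs_realify x W).2 Wx)).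
move=> x Dx; have [L [M [M0 LD LZ LM Lx]]] := Dd x Dx.
exists (fun u => emb K (L u)); split.
- by move=> u v; rewrite LD rmorphD.
- move=> t u tr; have -> : t *: u = (re t *: (u : XR) : XR).
    by rewrite realify_scaleE real_re.
  by rewrite LZ rmorphM real_re.
- have LN v : L (- v) = - L v by rewrite -(@scaleN1r _ XR) LZ mulN1r.
  apply: (@bounded_additive_continuous _ _ X K^o _ M) => [u v|u].
    by rewrite -rmorphB -LN -LD.
  by rewrite /rnorm norm_emb re_emb; apply: LM.
- apply/eqoP => eps eps0.
  have [r r0 hr] := Lx _ (re_gt0 eps0).
  have /nbhs_normP[q /= q0 qU] : nbhs (x : XR) (U : set XR).
    by apply: open_nbhs_nbhs; split=> //; apply: DU.
  apply/nbhs_rnorm; exists (Num.min r q); first by rewrite lt_min r0.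
  move=> h; rewrite sub0r rnormN lt_min => /andP[h_r h_q].
  have Uxh : U (x + h).
    by apply: qU; rewrite /= realify_normE opprD addNKr rnormN.
  rewrite !fg//; last exact: DU.
  rewrite -!rmorphB norm_emb -(emb_re (ltW eps0)) -(emb_rnorm h) -rmorphM emb_le.
  exact: hr.
Qed.

End AsplundCriterion.

(** * Linear spans, suprema and interpolation by total families *)

Section LinSpan.
Context {K : numFieldType} {V : lmodType K}.
Implicit Types (A P : set V).

Lemma lin_span0 A : lin_span A 0.
Proof.
exists 0, (fun=> 0), (fun=> 0); split; first by case.
by rewrite big_ord0.
Qed.

Lemma lin_spanZ A a v : lin_span A v -> lin_span A (a *: v).
Proof.
move=> [n [c [x [Ax ->]]]]; exists n, (fun i => a * c i), x; split=> //.
by rewrite scaler_sumr; apply: eq_bigr => i _; rewrite scalerA.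
Qed.

Lemma lin_spanD A u v : lin_span A u -> lin_span A v -> lin_span A (u + v).
Proof.
move=> [n [c [x [Ax ->]]]] [m [d [y [Ay ->]]]].
exists (n + m)%N, (fun i => match fintype.split i with inl j => c j | inr j => d j end),
  (fun i => match fintype.split i with inl j => x j | inr j => y j end); split.
  by move=> i; case: fintype.split.
by rewrite big_split_ord /=; congr (_ + _); apply: eq_bigr => i _;
  [rewrite (unsplitK (inl i))|rewrite (unsplitK (inr i))].
Qed.

Lemma sub_lin_span A v : A v -> lin_span A v.
Proof.
move=> Av; exists 1%N, (fun=> 1), (fun=> v); split=> //.
by rewrite big_ord1 scale1r.
Qed.

Lemma lin_span_ind A P : P 0 -> (forall u v, P u -> P v -> P (u + v)) ->
    (forall a v, P v -> P (a *: v)) -> (forall v, A v -> P v) ->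
  forall v, lin_span A v -> P v.
Proof.
move=> P0 PD PZ PA _ [n [c [x [Ax ->]]]].
by elim/big_ind: _ => // i _; apply/PZ/PA.
Qed.

Lemma lin_span_sum A (I : eqType) (s : seq I) (F : I -> V) :
  (forall i, A (F i)) -> lin_span A (\sum_(i <- s) F i).
Proof.
move=> AF; elim/big_ind: _ => [|u v|i _]; first exact: lin_span0.
  exact: lin_spanD.
exact: sub_lin_span.
Qed.

End LinSpan.

(** Gaussian elimination: a space of functionals that separates the points of
[W] takes arbitrary compatible values on finitely many vectors of [W]. One
vector [x] is dealt with by a functional [p] with [p x = 1]; the functionals
vanishing at [x] still separate the points of the kernel of [p]. *)
Lemma total_interpolation (K : fieldType) (V : lmodType K) (xs : seq V) :
  forall (W : set V) (S : set (V -> K^o)),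
    (forall a u v, W u -> W v -> W (a *: u + v)) ->
    (forall a f g, S f -> S g -> S (a *: f + g)) -> S 0 ->
    (forall f, S f -> linear f) ->
    (forall v, W v -> (forall f, S f -> f v = 0) -> v = 0) ->
    {in xs, forall x, W x} ->
  forall f0 : V -> K^o, linear f0 -> exists2 f, S f & {in xs, f =1 f0}.
Proof.
move: {2}(size xs) (erefl (size xs)) => n.
elim: n xs => [|n IH] [|x xs] //= => [_|[sz]] W S Wlin Slin S0 Slinear tot Wxs f0 f0lin.
  by exists 0.
have lin0 (f : V -> K^o) : linear f -> f 0 = 0.
  by move=> fl; have := fl (-1) 0 0; rewrite scaleN1r oppr0 addr0 scaleN1r addNr.
have linZ (f : V -> K^o) a v : linear f -> f (a *: v) = a * f v.
  by move=> fl; have := fl a v 0; rewrite !addr0 lin0// addr0.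
have linB (f : V -> K^o) a u v : linear f -> f (u - a *: v) = f u - a * f v.
  by move=> fl; rewrite addrC -scaleNr fl addrC; congr (_ + _); apply: mulNr.
have Wx : W x by apply: Wxs; rewrite mem_head.
have W0 : W 0 by have := Wlin (-1) x x Wx Wx; rewrite scaleN1r addNr.
have [x0|x0] := eqVneq x 0.
  have [|f Sf fxs] := IH xs sz W S Wlin Slin S0 Slinear tot _ f0 f0lin.
    by move=> y yxs; apply: Wxs; rewrite inE yxs orbT.
  exists f => // y; rewrite inE => /orP[/eqP->|/fxs//].
  by rewrite x0 !lin0//; apply: Slinear.
have [p Sp px] : exists2 p, S p & p x = 1.
  have [[f Sf /eqP fx]|nf] := pselect (exists2 f, S f & f x <> 0).
    exists ((f x)^-1 *: f); last by rewrite fctE /=; apply: mulVf.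
    by have := Slin (f x)^-1 f 0 Sf S0; rewrite addr0.
  case/eqP: x0; apply: tot => // f Sf; apply: contrapT => fx.
  by apply: nf; exists f.
have plin := Slinear p Sp.
pose ys := [seq y - p y *: x | y <- xs].
have [|||||||f [Sf fx0] fys] := IH ys _ [set v | W v /\ p v = 0] [set f | S f /\ f x = 0] _ _ _ _ _ _ f0 f0lin.
- by rewrite size_map.
- move=> a u v [Wu pu] [Wv pv]; split; first exact: Wlin.
  by rewrite plin pu pv scaler0 addr0.
- move=> a f g [Sf fx] [Sg gx]; split; first exact: Slin.
  by rewrite !fctE fx gx scaler0 addr0.
- by split.
- by move=> f [/Slinear].
- move=> v [Wv pv] hv; apply: tot => // f Sf.
  have := hv (- f x *: p + f) _; rewrite !fctE pv scaler0 add0r; apply.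
  split; first exact: Slin.
  by rewrite px; rewrite /GRing.scale /= mulr1 addNr.
- move=> z; rewrite /ys => /mapP[y yxs ->]; split; last by rewrite linB// px mulr1 subrr.
  by rewrite addrC -scaleNr; apply: Wlin => //; apply: Wxs; rewrite inE yxs orbT.
have flin := Slinear f Sf.
exists (f0 x *: p + f); first exact: Slin.
move=> y; rewrite inE !fctE => /orP[/eqP->|yxs].
  by rewrite px fx0 addr0; apply: mulr1.
have := fys _ (map_f (fun y => y - p y *: x) yxs).
rewrite !linB// fx0 mulr0 subr0 => ->.
by rewrite /GRing.scale /= mulrC addrC subrK.
Qed.

Section Supremum.
Context {R : realType} {K : scalars R}.

(** Although the order of the scalars may be partial, a nonempty set of
nonnegative scalars that is bounded above has the supremum of its real parts
as its least upper bound. *)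
Lemma supremum_emb (A : set K) (M : R) : A !=set0 ->
    (forall a, A a -> 0 <= a) -> (forall a, A a -> a <= emb K M) ->
  exists s : R, [/\ supremum 0 A = emb K s, forall a, A a -> a <= emb K s
    & forall t : R, (forall a, A a -> a <= emb K t) -> s <= t].
Proof.
move=> [a0 Aa0] A0 AM; pose B := [set re a | a in A].
have Bsup : has_sup B.
  split; first by exists (re a0), a0.
  by exists M => _ [a Aa <-]; rewrite -(emb_le (K := K)) emb_re ?A0 ?AM.
have ub a : A a -> a <= emb K (sup B).
  move=> Aa; rewrite -[a]emb_re ?A0// emb_le; apply: ub_le_sup; first by case: Bsup.
  by exists a.
have sup_le t : (forall a, A a -> a <= emb K t) -> sup B <= t.
  move=> At; apply: ge_sup; first by case: Bsup.
  by move=> _ [a Aa <-]; rewrite -(emb_le (K := K)) emb_re ?A0// At.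
exists (sup B); split=> //.
have supA : supremums A (emb K (sup B)).
  split=> [a /ub//|y Ay].
  have y0 : 0 <= y by apply: le_trans (A0 _ Aa0) (Ay _ Aa0).
  by rewrite -(emb_re y0) emb_le; apply: sup_le => a Aa; rewrite emb_re//; apply: Ay.
rewrite /supremum ifF; last by apply/negbTE/set0P; exists a0.
by apply: (is_subset1_supremums _ supA); apply: xgetPex; exists (emb K (sup B)).
Qed.

End Supremum.

(** * The function space of the ladder compact and its Markushevich basis *)

Section Space.
Context {R : realType} (K : scalars R) (G : omega1).

Definition pt := {A : G -> bool | ladder_closure A}.

Lemma coord_bounded (g : G) :
  @bounded_pred R K pt (fun A => (sval A g)%:R).
Proof.
apply/asboolP; exists 1 => A; case: (sval A g); rewrite /rnorm ?normr1 ?normr0.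
  by rewrite re1.
by rewrite re0 ler01.
Qed.

Definition coord (g : G) : linf K pt := Linf (coord_bounded g).

Let V := linf K pt.
Let Y : set V := [set x | forall t : R, 0 < t ->
  exists2 v, lin_span (range coord) v & rnorm (x - v) < t].

Let Y_closed : closed Y.
Proof.
move=> x clx t t0; have t2 : 0 < t / 2 by rewrite divr_gt0.
have [y [Yy /= xy]] : (Y `&` [set y | rnorm (x - y) < t / 2]) !=set0.
  by apply: clx; apply/nbhs_rnorm; exists (t / 2).
have [d Dd yd] := Yy _ t2; exists d => //.
rewrite -[x](subrK y) -addrA; apply: le_lt_trans (rnormD _ _) _.
by rewrite [t]splitr ltrD.
Qed.

Let Y_0 : Y 0.
Proof.
move=> t t0; exists 0; first exact: lin_span0.
by rewrite subrr /rnorm normr0 re0.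
Qed.

Let Y_D x y : Y x -> Y y -> Y (x + y).
Proof.
move=> Yx Yy t t0; have t2 : 0 < t / 2 by rewrite divr_gt0.
have [a Da xa] := Yx _ t2; have [b Db yb] := Yy _ t2.
exists (a + b); first exact: lin_spanD.
by rewrite opprD addrACA (le_lt_trans (rnormD _ _))// [t]splitr ltrD.
Qed.

Let Y_Z a x : Y x -> Y (a *: x).
Proof.
move=> Yx t t0; have a1 : 0 < re `|a| + 1 by rewrite ltr_wpDl// re_ge0.
have [d Dd xd] := Yx _ (divr_gt0 t0 a1).
exists (a *: d); first exact: lin_spanZ.
rewrite -scalerBr rnormZ; apply: le_lt_trans (_ : (re `|a| + 1) * rnorm (x - d) < _).
  by rewrite ler_wpM2r ?rnorm_ge0// lerDl.
by rewrite mulrC -ltr_pdivlMr.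
Qed.

Definition ladder_subspace : closed_subspace V := ClosedSubspace Y_closed Y_0 Y_D Y_Z.

Definition ladder_space : completeNormedModType K := @cs_type K V ladder_subspace.
Local Notation X := ladder_space.

Definition app (x : X) : pt -> K^o := linf_fun (cs_val x).

Lemma appD x y A : app (x + y) A = app x A + app y A.
Proof. by rewrite /app cs_valD linfD. Qed.

Lemma appN x A : app (- x) A = - app x A.
Proof. by rewrite /app cs_valN linfN. Qed.

Lemma appZ a x A : app (a *: x) A = a * app x A.
Proof. by rewrite /app cs_valZ linfZ. Qed.

Lemma app_le x A : rnorm (app x A) <= rnorm x.
Proof. exact: le_linf. Qed.

Lemma rnorm_le_app x M : 0 <= M -> (forall A, rnorm (app x A) <= M) -> rnorm x <= M.
Proof. by move=> M0 h; apply: (@linf_le R K pt (cs_val x)). Qed.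

Lemma coord_in g : cs_set ladder_subspace (coord g).
Proof.
move=> t t0; exists (coord g); first by apply: sub_lin_span; exists g.
by rewrite subrr /rnorm normr0 re0.
Qed.

Definition basis (g : G) : X := cs_in (coord_in g).

Lemma app_basis g A : app (basis g) A = (sval A g)%:R.
Proof. by []. Qed.

Lemma span_approx (x : X) (t : R) : 0 < t ->
  exists2 v, lin_span (range basis) v & rnorm (x - v) < t.
Proof.
move=> t0; have [v vs xv] := (cs_valP x : Y _) t t0.
suff [w ws wv] : exists2 w, lin_span (range basis) w & cs_val w = v.
  by exists w => //; rewrite -wv in xv.
move: v vs {xv}; apply: lin_span_ind.
- by exists 0; first exact: lin_span0.
- by move=> u v [u' su <-] [v' sv <-]; exists (u' + v'); first exact: lin_spanD.
- by move=> a v [v' sv <-]; exists (a *: v'); first exact: lin_spanZ.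
- by move=> _ [g _ <-]; exists (basis g) => //; apply: sub_lin_span; exists g.
Qed.

(** Elements of the space are uniform limits of functions of finitely many
coordinates. *)
Lemma finite_dependence (x : X) (t : R) : 0 < t ->
  exists s : seq G, forall A B : pt, {in s, sval A =1 sval B} ->
    rnorm (app x A - app x B) <= t.
Proof.
move=> t0; have t2 : 0 < t / 2 by rewrite divr_gt0.
have [v vs xv] := span_approx x t2.
have [s sP] : exists s : seq G, forall A B : pt, {in s, sval A =1 sval B} ->
    app v A = app v B.
  move: v vs {xv}; apply: lin_span_ind.
  - by exists [::].
  - move=> u v [s us] [r vr]; exists (s ++ r) => A B AB; rewrite !appD.
    by rewrite (us A B) ?(vr A B)// => g gs; apply: AB; rewrite mem_cat gs ?orbT.
  - by move=> a v [s vs]; exists s => A B AB; rewrite !appZ (vs A B).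
  - move=> _ [g _ <-]; exists [:: g] => A B AB.
    by rewrite !app_basis AB// mem_head.
exists s => A B AB.
have -> : app x A - app x B = app (x - v) A - app (x - v) B.
  by rewrite !appD !appN (sP A B AB) opprD addrACA subrr addr0.
apply: le_trans (rnormD _ _) _; rewrite rnormN [t]splitr.
by apply: lerD; apply: le_trans (app_le _ _) (ltW xv).
Qed.

Definition initial_pt (A : G -> bool)
    (Ad : forall a b, o1lt b a -> A a -> A b) : pt :=
  exist _ A (ladder_closure_initial Ad).

Definition ladder_pt a n : pt := exist _ _ (@ladder_closure_ladder G a n).

(** [ladder g 0] is the list [:: g], so this is evaluation at a singleton. *)
Definition coef (g : G) : X -> K^o := fun x => app x (ladder_pt g 0).

Lemma app_linear A : linear (fun x : X => app x A).
Proof. by move=> a x y; rewrite appD appZ. Qed.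

Lemma app_dual A : dual (fun x : X => app x A).
Proof.
split; first exact: app_linear.
apply: (@bounded_additive_continuous _ _ X K^o _ 1) => [x y|x].
  by rewrite appD appN.
by rewrite mul1r app_le.
Qed.

Lemma ladder_biorthogonal : biorthogonal_system basis coef.
Proof.
split=> [g|a b]; first exact: app_dual.
rewrite /coef app_basis /= ladder0 inE eq_sym.
by congr (_%:R); congr nat_of_bool; apply/eqP/asboolP.
Qed.

Lemma ladder_span_dense : dense (lin_span (range basis)).
Proof.
move=> U [x Ux] oU; have /nbhs_rnorm[e e0 h] := open_nbhs_nbhs (conj oU Ux).
by have [v vs xv] := span_approx x e0; exists v; split=> //; apply: h.
Qed.

(** Both sides agree on the basis, hence on its span, and depend continuously
on [x]. *)
Lemma app_ladder a n (x : X) :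
  app x (ladder_pt a n) = \sum_(g <- undup (ladder a n)) coef g x.
Proof.
have coefD g u v : coef g (u + v) = coef g u + coef g v by exact: appD.
have coefZ g b v : coef g (b *: v) = b * coef g v by exact: appZ.
have onspan v : lin_span (range basis) v ->
    app v (ladder_pt a n) = \sum_(g <- undup (ladder a n)) coef g v.
  move: v; apply: lin_span_ind.
  - by rewrite big1.
  - move=> u v hu hv; rewrite appD hu hv -big_split; apply: eq_bigr => g _.
    by rewrite coefD.
  - move=> b v hv; rewrite appZ hv mulr_sumr; apply: eq_bigr => g _.
    by rewrite coefZ.
  - move=> _ [h _ <-]; rewrite app_basis /=.
    have E g : coef g (basis h) = (h == g)%:R.
      by rewrite /coef app_basis /= ladder0 inE.
    under eq_bigr => g _ do rewrite E.
    have [hs|hs] := boolP (h \in ladder a n).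
      rewrite (bigD1_seq h) ?mem_undup ?undup_uniq//= eqxx big1 ?addr0// => g gh.
      by rewrite eq_sym (negPf gh).
    rewrite big1_seq// => g /=; rewrite mem_undup => gs.
    by have [E'|//] := eqVneq h g; rewrite E' gs in hs.
apply/eqP; rewrite -subr_eq0 -normr_eq0 -emb_rnorm; apply/eqP.
rewrite -[RHS](rmorph0 (emb K)); congr (emb K _); apply/eqP.
rewrite eq_le rnorm_ge0 andbT; apply/ler_addgt0Pr => t t0; rewrite add0r.
set m := size (undup (ladder a n)).
(* [m] values of coefficient functionals and one evaluation of the same error. *)
have m1 : 0 < m.+1%:R :> R by [].
have [v vs xv] := span_approx x (divr_gt0 t0 m1).
have xE : x = (x - v) + v by rewrite subrK.
move: (x - v) xE xv => w {x} -> wv.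
have -> : \sum_(g <- undup (ladder a n)) coef g (w + v) =
    \sum_(g <- undup (ladder a n)) coef g w + \sum_(g <- undup (ladder a n)) coef g v.
  by rewrite -big_split; apply: eq_bigr => g _; apply: coefD.
rewrite appD (onspan v vs) opprD addrACA subrr addr0.
apply: le_trans (rnormD _ _) _; rewrite rnormN.
have le_sum : rnorm (\sum_(g <- undup (ladder a n)) coef g w : K^o) <=
    m%:R * rnorm w.
  rewrite /m; elim: (undup _) => [|g s IH].
    by rewrite big_nil mul0r /rnorm normr0 re0.
  rewrite big_cons; apply: le_trans (rnormD _ _) _.
  by rewrite /= -natr1 mulrDl mul1r addrC lerD// app_le.
apply: le_trans (_ : m.+1%:R * rnorm w <= _).
  by rewrite -natr1 mulrDl mul1r addrC lerD// app_le.
by rewrite mulrC -ler_pdivlMr// ltW.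
Qed.

End Space.

Section Norming.
Context {R : realType} (K : scalars R) (G : omega1).
Local Notation X := (ladder_space K G).
Local Notation coef := (@coef R K G).
Local Notation basis := (@basis R K G).

Lemma span_coef_bounded (psi : X -> K^o) : lin_span (range coef) psi ->
  linear psi /\ exists2 C : R, 0 <= C & forall x, rnorm (psi x) <= C * rnorm x.
Proof.
move: psi; apply: lin_span_ind.
- split=> [a u v|]; first by rewrite /= scaler0 addr0.
  exists 0 => // x; by rewrite mul0r /rnorm normr0 re0.
- move=> f g [fl [C C0 fC]] [gl [D D0 gD]]; split=> [a u v|].
    by rewrite !fctE fl gl scalerDr addrACA.
  exists (C + D) => [|x]; first exact: addr_ge0.
  by apply: le_trans (rnormD _ _) _; rewrite mulrDl lerD.
- move=> a f [fl [C C0 fC]]; split=> [b u v|].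
    by rewrite !fctE fl scalerDr !scalerA mulrC.
  exists (re `|a| * C) => [|x]; first by rewrite mulr_ge0// re_ge0.
  by rewrite rnormZ -mulrA ler_wpM2l ?re_ge0.
- move=> _ [g _ <-]; split; first exact: app_linear.
  by exists 1 => // x; rewrite mul1r app_le.
Qed.

(** A bound [C] is what guarantees that the set of values has a supremum. *)
Lemma dual_norm_spec (psi : X -> K^o) (C : R) : linear psi -> 0 <= C ->
    (forall x, rnorm (psi x) <= C * rnorm x) ->
  exists s : R, [/\ dual_norm psi = emb K s, s <= C
    & forall x, rnorm (psi x) <= s * rnorm x].
Proof.
move=> pl C0 pC; rewrite /dual_norm; set A := [set _ | _ in _].
have p0 : psi 0 = 0.
  by have := pl (-1) 0 0; rewrite scaleN1r oppr0 addr0 scaleN1r addNr.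
have pZ a x : psi (a *: x) = a * psi x.
  by have := pl a x 0; rewrite !addr0 p0 addr0.
have A0 : A !=set0 by exists `|psi 0|; exists 0 => //=; rewrite normr0.
have AC a : A a -> a <= emb K C.
  move=> [x /= x1 <-]; rewrite le_rnorm; apply: le_trans (pC x) _.
  by rewrite ler_piMr// -le_rnorm rmorph1.
have [|s [sE ub lub]] := supremum_emb A0 _ AC; first by move=> _ [x _ <-].
exists s; split=> //; first exact: lub.
move=> x; have [x0|x0] := eqVneq x 0.
  by rewrite x0 p0 /rnorm !normr0 re0 mulr0.
have nx : 0 < rnorm x by rewrite re_gt0// normr_gt0.
have : A `|psi ((emb K (rnorm x)^-1) *: x)|.
  exists (emb K (rnorm x)^-1 *: x) => //=.
  rewrite normrZ norm_emb -(emb_rnorm x) -rmorphM gtr0_norm ?invr_gt0//.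
  by rewrite mulVf ?gt_eqF// rmorph1.
move=> /ub; rewrite pZ le_rnorm /rnorm re_normM norm_emb re_emb.
by rewrite ger0_norm ?invr_ge0 ?(ltW nx)// mulrC ler_pdivrMr.
Qed.

(** Evaluations at finite sets are norm-one combinations of the coefficient
functionals, and finite sets are dense in the compact set. *)
Lemma ladder_norming : norming coef 1.
Proof.
move=> y; rewrite mul1r; set A := [set _ | _ in _].
have A0 : A !=set0.
  exists `|(0 : X -> K^o) y|; exists 0 => //; split; first exact: lin_span0.
  have [||s [-> s0 _]] := @dual_norm_spec 0 0 _ (lexx 0).
  - by move=> a u v; rewrite /= scaler0 addr0.
  - by move=> x; rewrite mul0r /rnorm normr0 re0.
  - by rewrite -(rmorph1 (emb K)) emb_le (le_trans s0).
have AM a : A a -> a <= emb K (rnorm y).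
  move=> [psi [/= ps p1] <-]; have [pl [C C0 pC]] := span_coef_bounded ps.
  have [s [sE _ sP]] := dual_norm_spec pl C0 pC.
  rewrite le_rnorm; apply: le_trans (sP y) _; rewrite ler_piMl ?rnorm_ge0//.
  by rewrite -(emb_le (K := K)) -sE rmorph1.
have [|s [-> ub _]] := supremum_emb A0 _ AM; first by move=> _ [psi _ <-].
have Al a n : rnorm (app y (ladder_pt a n)) <= s.
  rewrite -le_rnorm; apply: ub; exists (fun x => app x (ladder_pt a n)) => //; split.
    have -> : (fun x => app x (ladder_pt a n)) = \sum_(g <- undup (ladder a n)) coef g.
      by apply/funext => x; rewrite app_ladder fct_sumE.
    by apply: lin_span_sum => g; exists g.
  have [||t [-> t1 _]] := @dual_norm_spec (fun x => app x (ladder_pt a n)) 1 _ ler01.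
  - exact: app_linear.
  - by move=> x; rewrite mul1r app_le.
  - by rewrite -(rmorph1 (emb K)) emb_le.
rewrite le_rnorm; apply: rnorm_le_app => [|B].
  have [a _] := exists_notin (Nil G).
  exact: le_trans (rnorm_ge0 _) (Al a 0%N).
apply/ler_addgt0Pr => t t0; have [l lP] := finite_dependence y t0.
have [a [n an]] := svalP B l.
rewrite -[app y B](subrK (app y (ladder_pt a n))) addrC.
by apply: le_trans (rnormD _ _) _; apply: lerD => //; apply: lP.
Qed.

Lemma coef_total (x : X) : (forall g, coef g x = 0) -> x = 0.
Proof.
move=> x0; have Al a n : app x (ladder_pt a n) = 0.
  by rewrite app_ladder big1.
suff : rnorm x <= 0.
  move=> h; apply/eqP; rewrite -normr_eq0 -emb_rnorm -(rmorph0 (emb K)).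
  by rewrite (inj_eq emb_inj) eq_le h rnorm_ge0.
apply: rnorm_le_app => // B; apply/ler_addgt0Pr => t t0; rewrite add0r.
have [l lP] := finite_dependence x t0; have [a [n an]] := svalP B l.
by have := lP B (ladder_pt a n) an; rewrite Al subr0.
Qed.

(** Total families are dense: a functional may be interpolated exactly at any
finite set of points, and the filter of the functionals that do so converges
pointwise. *)
Lemma coef_weakstar_dense :
  dense ([set psi | lin_span (range coef) (val psi)] : set (weakstar_space X)).
Proof.
have span_dual psi : lin_span (range coef) psi -> dual psi.
  move=> /span_coef_bounded[pl [C C0 pC]]; split=> //.
  apply: (@bounded_additive_continuous _ _ X K^o _ C) pC => u v.
  by have := pl (-1) v u; rewrite !scaleN1r => h; rewrite addrC h addrC.
move=> Q [psi0 Qpsi] [W oW WQ]; rewrite -WQ in Qpsi *.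
have [psi0l psi0c] : dual (val psi0) by have := valP psi0; rewrite inE.
have match_psi (xs : seq X) : exists psi : set_type (@dual K X),
    lin_span (range coef) (val psi) /\ {in xs, val psi =1 val psi0}.
  have [|||||||psi ps xsE] := @total_interpolation K X xs setT (lin_span (range coef)) _ _ _ _ _ _ (val psi0).
  - by [].
  - by move=> a f g fs gs; apply: lin_spanD => //; apply: lin_spanZ.
  - exact: lin_span0.
  - by move=> f /span_coef_bounded[].
  - move=> v _ h; apply: coef_total => g; apply: h; apply: sub_lin_span.
    by exists g.
  - by [].
  - exact: psi0l.
  have psid : psi \in (@dual K X) by rewrite inE; apply: span_dual.
  by exists (Sub psi psid : set_type (@dual K X)); rewrite SubK.
pose C (xs : seq X) := [set psi : set_type (@dual K X) |
  lin_span (range coef) (val psi) /\ {in xs, val psi =1 val psi0}].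
pose F : set_system (set_type (@dual K X)) := filter_from setT C.
have FF : Filter F.
  apply: filter_from_filter; first by exists [::].
  move=> xs ys _ _; exists (xs ++ ys) => // psi [ps h]; split; split=> // x xs'.
    by apply: h; rewrite mem_cat xs'.
  by apply: h; rewrite mem_cat xs' orbT.
have PF : ProperFilter F.
  by apply: filter_from_proper => xs _; have [psi h] := match_psi xs; exists psi.
have Fcvg : {ptws, (fun psi : set_type (@dual K X) => val psi : X -> K^o) @ F --> val psi0}.
  apply/pointwise_cvgP => x; apply/(@cvg_rnorm _ _ K^o) => t t0.
  exists [:: x] => // psi [_ /(_ x (mem_head _ _)) E].
  by rewrite /= E subrr /rnorm normr0 re0 ltW.
have FW : F (fun psi => W (val psi)).
  by apply: Fcvg; apply: open_nbhs_nbhs.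
have FC : F (C [::]) by exists [::].
have [psi [Wp [ps _]]] := filter_ex (filterI FW FC).
by exists psi.
Qed.

Lemma ladder_markushevich : norming_markushevich_basis basis coef 1.
Proof.
split; last exact: ladder_norming.
split; [exact: ladder_biorthogonal|exact: ladder_span_dense|].
exact: coef_weakstar_dense.
Qed.

End Norming.

(** * The space is not weakly compactly generated *)

Section NotWCG.
Context {R : realType} (K : scalars R) (G : omega1).
Local Notation X := (ladder_space K G).
Local Notation lt := (@o1lt G).

Lemma exists_above (B : set G) : countable B ->
  exists c, forall b, B b -> lt b c.
Proof.
move=> Bc; pose D := \bigcup_(b in B) [set x | x = b \/ lt x b].
have Dc : countable D.
  by apply: bigcup_countable => // b _; exact: countable_below.
apply: contrapT => /forallNP h; apply: (@o1uncount G).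
apply: sub_countable Dc; apply: subset_card_le => c _.
have /existsNP[b /not_implyP[Bb nbc]] := h c; exists b => //=.
by have [?|?|?] := o1total b c; [|left|right].
Qed.

Definition initial_segment (c : G) : pt G :=
  @initial_pt G (fun g => lt g c) (fun a b ba ac => o1trans ba ac).

Definition whole : pt G := @initial_pt G xpredT (fun _ _ _ _ => isT).

(** For each [x], evaluations at long initial segments approach evaluation at
the whole of [G], by [finite_dependence]. Where this happens depends on [x],
but compactness puts a common bound [b] on it. *)
Lemma weakly_compact_return (W : set X) (a : G) (t : R) :
    compact (W : set (weak_space X)) -> 0 < t ->
  exists b, lt a b /\ forall x, W x -> exists c,
    [/\ lt a c, lt c b & rnorm (app x (initial_segment c) - app x whole) < t].
Proof.
move=> cW t0; have /compact_near_coveringP ncW := cW.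
pose F : set_system G := filter_from setT (fun c => [set b | lt c b]).
have FF : Filter F.
  apply: filter_from_filter; first by exists a.
  move=> c d _ _; have [e he] := exists_above (finite_set_countable (finite_seq [:: c; d])).
  exists e => // b /= eb; split; apply: o1trans eb; apply: he => /=.
    by rewrite mem_head.
  by rewrite inE mem_head orbT.
pose P b (x : weak_space X) := exists c,
    [/\ lt a c, lt c b & rnorm (app x (initial_segment c) - app x whole) < t].
have [|b0 _ hb] := ncW G F P FF.
  move=> x Wx; have t2 : 0 < t / 2 by rewrite divr_gt0.
  have [s sP] := finite_dependence (x : X) t2.
  have [c hc] := exists_above (finite_set_countable (finite_seq (a :: s))).
  pose phi (y : X) : K^o := app y (initial_segment c) - app y whole.
  have phid : dual phi.
    have [l1 c1] := @app_dual _ K _ (initial_segment c); have [l2 c2] := @app_dual _ K _ whole.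
    split=> [k u v|y]; first by rewrite /phi l1 l2 scalerBr opprD addrACA.
    by apply: continuousB; [exact: c1|exact: c2].
  have phi_weak : continuous (phi : weak_space X -> K^o).
    have phim : phi \in (@dual K X) by rewrite inE.
    pose phis : set_type (@dual K X) := Sub phi phim.
    move=> y; apply: (@continuous_comp _ _ _
      (fun (x : weak_space X) => (fun psi => val psi x) : {ptws set_type (@dual K X) -> K^o})
      (@proj _ (fun=> K^o) phis)).
      exact: initial_continuous.
    exact: proj_continuous.
  have phix : rnorm (phi x) <= t / 2.
    by apply: sP => g gs; rewrite /= hc//= inE gs orbT.
  exists ([set y : weak_space X | rnorm (phi x - phi y) <= t / 4], [set b | lt c b]).
    split; last by exists c.
    have /cvg_rnorm : phi @ (x : weak_space X) --> phi x by exact: phi_weak.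
    by apply; rewrite divr_gt0.
  move=> [y b] /= [xy cb]; exists c; split=> //; first by apply: hc; rewrite /= mem_head.
  rewrite -/(phi y) -[phi y](subrK (phi x)); apply: le_lt_trans (rnormD _ _) _.
  by rewrite rnorm_distrC; move: xy phix; lra.
have [b hb'] := exists_above (finite_set_countable (finite_seq [:: a; b0])).
exists b; split; first by apply: hb'; rewrite /= mem_head.
by move=> x Wx; apply: (hb b) => //=; apply: hb'; rewrite /= inE mem_head orbT.
Qed.

(** A weakly compact set cannot tell the whole of [G] from a suitable countable
initial segment [B]: take for [B] the union of the segments given by iterating
[weakly_compact_return] with ever smaller errors. *)
Lemma weakly_compact_segment (W : set X) : compact (W : set (weak_space X)) ->
  exists (B : pt G), (exists g, ~~ sval B g) /\
    forall x, W x -> app x B = app x whole.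
Proof.
move=> cW; have [a0 _] := exists_notin (Nil G).
have step (ak : G * nat) : exists b, lt ak.1 b /\ forall x, W x -> exists c,
    [/\ lt ak.1 c, lt c b &
        rnorm (app x (initial_segment c) - app x whole) < ak.2.+1%:R^-1].
  by apply: weakly_compact_return => //; rewrite invr_gt0.
have [next nextP] := choice step.
pose a := fix a k := if k is k'.+1 then next (a k', k') else a0.
have aS k : lt (a k) (a k.+1) by have [] := nextP (a k, k).
have amono k n : (k <= n)%N -> a k = a n \/ lt (a k) (a n).
  elim: n => [|n IH]; first by rewrite leqn0 => /eqP->; left.
  rewrite leq_eqVlt => /orP[/eqP->|]; first by left.
  by rewrite ltnS => /IH[->|h]; right=> //; apply: o1trans (aS n).
pose Bset g := exists k, lt g (a k).
have Bd g h : lt h g -> `[< Bset g >] -> `[< Bset h >].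
  by move=> hg /asboolP[k gk]; apply/asboolP; exists k; apply: o1trans gk.
pose B : pt G := @initial_pt G (fun g => `[< Bset g >]) Bd.
exists B; split.
  have ac : countable (range a) by apply: sub_countable (card_image_le a setT) (countableP _).
  have [g hg] := exists_above ac; exists g => /=; apply/asboolP => -[k gk].
  have := o1trans gk (hg (a k) (ex_intro2 _ _ k Logic.I erefl)).
  by rewrite o1irr.
move=> x Wx; apply/eqP; rewrite -subr_eq0 -normr_eq0 -emb_rnorm -(rmorph0 (emb K)).
rewrite (inj_eq emb_inj) eq_le rnorm_ge0 andbT; apply/ler_addgt0Pr => t t0; rewrite add0r.
have t2 : 0 < t / 2 by rewrite divr_gt0.
have [s sP] := finite_dependence x t2.
have [k1 hk1] : exists k1, forall g, g \in s -> Bset g -> lt g (a k1).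
  elim: {sP} s => [|g s [k hk]]; first by exists 0%N.
  have [[m gm]|nB] := pselect (Bset g).
    exists (maxn k m) => h; rewrite inE => /orP[/eqP-> _|hs Bh].
      by have [<-//|] := amono m (maxn k m) (leq_maxr _ _); apply: o1trans.
    by have [<-|] := amono k (maxn k m) (leq_maxl _ _); [apply: hk|apply: o1trans; apply: hk].
  exists k => h; rewrite inE => /orP[/eqP->//|]; exact: hk.
pose k := maxn k1 (Num.bound (t / 2)^-1).
have [_ /(_ x Wx)[c [/= ac ca cx]]] := nextP (a k, k).
have kt : k.+1%:R^-1 <= t / 2 :> R.
  rewrite invf_ple ?posrE//; apply: ltW.
  apply: lt_le_trans (archi_boundP _) _; first by rewrite invr_ge0 ltW.
  by rewrite ler_nat leqW// leq_maxr.
rewrite -[app x B](subrK (app x (initial_segment c))) -addrA [t]splitr.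
apply: le_trans (rnormD _ _) _; apply: lerD; last exact: le_trans (ltW cx) kt.
apply: sP => g gs /=; apply/asboolP/idP => [Bg|gc].
  apply: o1trans ac; have := hk1 g gs Bg.
  by have [->//|h] := amono k1 k (leq_maxl _ _); move=> h'; apply: o1trans h.
by exists k.+1; apply: o1trans ca.
Qed.

(** A weakly compact set spanning a dense subspace would make the evaluations
at [B] and at [G] equal, and they differ on [basis g] for [g] outside [B]. *)
Theorem ladder_not_WCG : ~ weakly_compactly_generated X.
Proof.
move=> [W [cW dW]]; have [B [[g nBg] Beq]] := weakly_compact_segment cW.
have Bspan v : lin_span W v -> app v B = app v whole.
  move: v; apply: lin_span_ind => //.
  - by move=> u v hu hv; rewrite !appD hu hv.
  - by move=> b v hv; rewrite !appZ hv.
have oball : open [set x : X | rnorm (basis K g - x) < 2^-1].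
  rewrite openE => x /= gx; apply/(@nbhs_rnorm _ _ X).
  exists (2^-1 - rnorm (basis K g - x)) => [|y xy]; first by rewrite subr_gt0.
  rewrite /= -[basis K g](subrK x) -addrA.
  by apply: le_lt_trans (rnormD _ _) _; move: xy; rewrite ltrBrDl.
have [|v [/= gv vs]] := dW _ _ oball.
  by exists (basis K g) => /=; rewrite subrr /rnorm normr0 re0 invr_gt0.
have h A : rnorm (app (basis K g) A - app v A) < 2^-1.
  by rewrite -appN -appD; apply: le_lt_trans (app_le _ _) gv.
have := h whole; have := h B; rewrite (Bspan v vs) !app_basis (negPf nBg) /= sub0r rnormN.
move=> h1 h2; have : rnorm (1 : K^o) < 1.
  rewrite -[1 : K^o](subrK (app v whole)); apply: le_lt_trans (rnormD _ _) _.
  by move: h1 h2; lra.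
by rewrite /rnorm normr1 re1 ltxx.
Qed.

End NotWCG.

(** * The Asplund property of the function space *)

Section LadderAsplund.
Context {R : realType} (K : scalars R) (G : omega1).
Local Notation X := (ladder_space K G).
Local Notation XR := (realify X).

Definition re_im_part (x : X) (p : pt G * bool) : R :=
  if p.2 then im (app x p.1) else re (app x p.1).

Lemma re_im_part_le x p : `|re_im_part x p| <= rnorm x.
Proof.
by rewrite /re_im_part; case: p.2; apply: le_trans (app_le x p.1);
  [apply: le_im|apply: le_re].
Qed.

Definition re_im (x : XR) : @rlinf R (pt G * bool) := sval (mk_rlinf (re_im_part_le x)).

Lemma re_imE x : rval (re_im x) = re_im_part x.
Proof. exact: svalP (mk_rlinf _). Qed.

(** Countably many elements depend on countably many coordinates, and on these
the compact set has countably many traces by [ladder_closure_traces]. *)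
Lemma ladder_Asplund : Asplund X.
Proof.
apply: (@asplund_criterion R K X _ re_im).
- move=> x y; apply: rval_inj => p; rewrite rvalD !re_imE /re_im_part appD.
  by case: p.2; rewrite ?reD ?imD.
- move=> t x; apply: rval_inj => p; rewrite rvalZ !re_imE /re_im_part realify_scaleE appZ.
  by case: p.2; rewrite ?re_embM ?im_embM.
- by move=> x; apply: rval_le => [|p]; rewrite ?rnorm_ge0// re_imE re_im_part_le.
- move=> x; apply: rnorm_le_app => [|A]; first by rewrite mulr_ge0.
  apply: le_trans (le_re_im _) _; rewrite mulr_natl mulr2n.
  have := le_rval (re_im x) (A, true); have := le_rval (re_im x) (A, false).
  by rewrite re_imE /re_im_part /= => h1 h2; apply: lerD.
move=> u.
have [a0 _] := exists_notin (Nil G).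
have dep (nk : nat * nat) : exists s : seq G, forall A B : pt G, {in s, sval A =1 sval B} ->
    rnorm (app (u nk.1 : X) A - app (u nk.1 : X) B) <= nk.2.+1%:R^-1.
  by apply: finite_dependence; rewrite invr_gt0.
have [s sP] := choice dep.
(* One sequence through all coordinates on which the [u n] depend. *)
pose c j : G := if unpickle j is Some (n, k, i) then nth a0 (s (n, k)) i else a0.
have [e [Ke eP]] := ladder_closure_traces c.
(* Even and odd indices serve the real and the imaginary parts. *)
pose e' j : pt G * bool := (exist _ (e j./2) (Ke j./2), odd j).
pose N j : set (set (pt G * bool)) := [set U | exists l : seq nat,
  forall A : pt G, {in l, forall i, sval A (c i) = e j./2 (c i)} -> U (A, odd j)].
exists e', N; split.
  split=> [j|j U V [l hU] [r hV]|U NU].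
  - by exists setT, [::].
  - exists (l ++ r) => A h; split; [apply: hU|apply: hV] => i hi; apply: h.
      by rewrite mem_cat hi.
    by rewrite mem_cat hi orbT.
  - have [l lP] := choice NU.
    have [A KA|m mP] := @ladder_closure_cover G e
        (fun i => map c (l i.*2 ++ l i.*2.+1)).
      have [i hi] := eP A KA; exists i => g /mapP[j _ ->]; exact: hi.
    exists m.*2 => -[[A KA] b]; have [i im_ hi] := mP A KA.
    exists (b + i.*2)%N; first by case: b; lia.
    have E : (b + i.*2)./2 = i by rewrite half_bit_double.
    have O : odd (b + i.*2) = b by rewrite oddD odd_double addbF oddb.
    have := lP (b + i.*2)%N (exist _ A KA); rewrite E O; apply => j jl.
    apply: hi; apply: map_f; rewrite mem_cat.
    by case: b jl {E O} => /= ->; rewrite ?orbT.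
move=> n j t t0.
pose k := Num.bound t^-1.
have kt : k.+1%:R^-1 <= t :> R.
  rewrite invf_ple ?posrE//; apply: ltW.
  apply: lt_le_trans (archi_boundP _) _; first by rewrite invr_ge0 ltW.
  by rewrite ler_nat.
pose l := [seq pickle (n, k, i) | i <- iota 0 (size (s (n, k)))].
exists [set p | p.2 = odd j /\ {in l, forall i, sval p.1 (c i) = e j./2 (c i)}].
  by exists l => A h.
move=> [A b] [/= -> hA]; rewrite re_imE.
have d : rnorm (app (u n : X) A - app (u n : X) (e' j).1) <= t.
  apply: le_trans kt; apply: (sP (n, k)) => g gs /=.
  have := hA (pickle (n, k, index g (s (n, k)))) _.
  rewrite /c pickleK nth_index//; apply; apply: map_f.
  by rewrite mem_iota /= add0n index_mem.
rewrite /re_im_part /=; case: (odd j); apply: le_trans d.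
  by rewrite -imB; apply: le_im.
by rewrite -reB; apply: le_re.
Qed.

End LadderAsplund.

Lemma ladder_space_example (R : realType) (K : scalars R) :
  exists X : completeNormedModType K,
    [/\ Asplund X,
        exists (Gamma : Type) (x : Gamma -> X) (phi : Gamma -> X -> K^o),
          norming_markushevich_basis x phi 1
      & ~ weakly_compactly_generated X].
Proof.
have [G] := omega1_exists; exists (ladder_space K G); split.
- exact: ladder_Asplund.
- by exists G, (@basis R K G), (@coef R K G); exact: ladder_markushevich.
- exact: ladder_not_WCG.
Qed.

Theorem theoremA (R : realType) :
  (exists X : completeNormedModType R,
     [/\ Asplund X,
         exists (Gamma : Type) (x : Gamma -> X) (phi : Gamma -> X -> R^o),
           norming_markushevich_basis x phi 1
       & ~ weakly_compactly_generated X]) /\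
  (exists X : completeNormedModType R[i],
     [/\ Asplund X,
         exists (Gamma : Type) (x : Gamma -> X) (phi : Gamma -> X -> R[i]^o),
           norming_markushevich_basis x phi 1
       & ~ weakly_compactly_generated X]).
Proof.
split; first exact: (ladder_space_example (real_scalars R)).
exact: (ladder_space_example (complex_scalars R)).
Qed.
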